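(* Let $G$, $H$ be countable discrete groups. Suppose there exists an $\bar H^1G$-faithful topologically free $(G,H)$ continuous orbit couple. If $H$ has property $H_{FD}$, then $G$ has property $H_{FD}$.
   Context: A topological dynamical system $G\curvearrowright X$ is an action by homeomorphisms on a locally compact Hausdorff space; it is topologically free if for all $g\neq e$ the set $\{x:g.x\neq x\}$ is dense. A $(G,H)$ continuous orbit couple consists of topological dynamical systems $G\curvearrowright X$ and $H\curvearrowright Y$ ($X$ is the $G$-space, $Y$ the $H$-space) and continuous maps $p:X\to Y$, $q:Y\to X$ for which there are continuous maps $a:G\times X\to H$, $b:H\times Y\to G$, $g:X\to G$, $h:Y\to H$ with $p(\gamma.x)=a(\gamma,x).p(x)$, $q(\eta.y)=b(\eta,y).q(y)$, $q(p(x))=g(x).x$, $p(q(y))=h(y).y$ for all $\gamma\in G,\eta\in H,x\in X,y\in Y$. It is topologically free if both systems are. For a unitary representation $\sigma$ of $G$, reduced cohomology is $\bar H^n(G,\sigma)=\ker(\partial^n)/\overline{\mathrm{im}(\partial^{n-1})}$, computed with the standard inhomogeneous (bar) cochain complex of maps $G^n\to\mathcal H_\sigma$ with the topology of pointwise convergence. A group $G$ has property $H_{FD}$ if for every unitary representation $\sigma$ of $G$, $\bar H^1(G,\sigma)\ncong\{0\}$ implies that $\sigma$ contains a (nonzero) finite dimensional subrepresentation. A covariant representation $(\Pi^X,\Pi^G)$ of $G\curvearrowright X$ ($X$ compact) is a representation $\Pi^X$ of $C(X)$ and a unitary representation $\Pi^G$ of $G$ on the same Hilbert space with $\Pi^G(g)\Pi^X(f)\Pi^G(g)^*=\Pi^X(f(g^{-1}.\,\cdot))$.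 A $(G,H)$ continuous orbit couple is $\bar H^1G$-faithful if its $G$- and $H$-spaces are second countable and compact, and its system $G\curvearrowright X$ has the property that for every unitary representation $\sigma$ of $G$ with $\bar H^1(G,\sigma)\ncong\{0\}$ there is a covariant representation $(\Pi^X,\Pi^G)$ of $G\curvearrowright X$ such that $\bar H^1(G,\sigma\otimes\Pi^G)\ncong\{0\}$. *)

(* Defs.v *)
From HB Require Import structures.
From mathcomp Require Import all_boot all_order all_algebra.
From mathcomp Require Import complex.
From mathcomp Require Import all_classical all_reals all_analysis.

Set Implicit Arguments.
Unset Strict Implicit.
Unset Printing Implicit Defensive.

Import Order.TTheory GRing.Theory Num.Theory.
Import numFieldNormedType.Exports.

Local Open Scope classical_set_scope.
Local Open Scope ring_scope.
Local Open Scope complex_scope.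

Record dynamical_system (G : groupType) (X : topologicalType) := DynamicalSystem {
  act :> G -> continuousType X X;
  act1 : forall x, act 1%g x = x;
  actM : forall g h x, act (g * h)%g x = act g (act h x);
  act_hausdorff : hausdorff_space X;
  act_locally_compact : locally_compact [set: X] }.

Definition topologically_free (G : groupType) (X : topologicalType)
    (S : dynamical_system G X) :=
  forall g : G, g <> 1%g -> dense [set x | S g x <> x].

(* The countable groups G and H carry the discrete topology. *)
Record orbit_couple (G H : groupType) := OrbitCouple {
  oc_X : topologicalType;
  oc_Y : topologicalType;
  oc_GX : dynamical_system G oc_X;
  oc_HY : dynamical_system H oc_Y;
  oc_p : continuousType oc_X oc_Y;
  oc_q : continuousType oc_Y oc_X;
  oc_cocycles :
    exists (a : continuousType (discrete_topology G * oc_X)%type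
                               (discrete_topology H))
           (b : continuousType (discrete_topology H * oc_Y)%type
                               (discrete_topology G))
           (g : continuousType oc_X (discrete_topology G))
           (h : continuousType oc_Y (discrete_topology H)),
      [/\ forall (s : G) x, oc_p (oc_GX s x) = oc_HY (a (s, x)) (oc_p x),
          forall (t : H) y, oc_q (oc_HY t y) = oc_GX (b (t, y)) (oc_q y),
          forall x, oc_q (oc_p x) = oc_GX (g x) x
        & forall y, oc_p (oc_q y) = oc_HY (h y) y] }.

Definition oc_topologically_free (G H : groupType) (O : orbit_couple G H) :=
  topologically_free (oc_GX O) /\ topologically_free (oc_HY O).

(* The inner product is linear in its first argument. *)
Record hilbert (R : realType) := Hilbert {
  hilbert_sort :> completeNormedModType R[i];
  dotp : {dot hilbert_sort for (@Num.conj R[i])};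
  dotp_norm : forall x, dotp x x = `|x| ^+ 2 }.

Record unitary_rep (R : realType) (G : groupType) (V : hilbert R) := UnitaryRep {
  urep :> G -> {linear V -> V};
  urep1 : forall v, urep 1%g v = v;
  urepM : forall g h v, urep (g * h)%g v = urep g (urep h v);
  urep_bij : forall g, bijective (urep g);
  urep_dotp : forall g v w, dotp V (urep g v) (urep g w) = dotp V v w }.

Section ReducedCohomology.
Variables (R : realType) (G : groupType) (V : hilbert R) (s : unitary_rep G V).

Definition cochain (n : nat) := {ptws ('I_n -> G) -> V}.

(* [(t_0, ..., t_j t_(j+1), ..., t_n)] *)
Definition merge_at (n : nat) (t : 'I_n.+1 -> G) (j i : 'I_n) : G :=
  if (i < j)%N then t (widen_ord (leqnSn n) i)
  else if i == j then (t (widen_ord (leqnSn n) i) * t (lift ord0 i))%g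
  else t (lift ord0 i).

Definition coboundary (n : nat) (f : cochain n) : cochain n.+1 :=
  fun t => s (t ord0) (f (fun i => t (lift ord0 i)))
    + \sum_(j < n) (-1) ^+ j.+1 *: f (merge_at t j)
    + (-1) ^+ n.+1 *: f (fun i => t (widen_ord (leqnSn n) i)).

Definition cocycles (n : nat) : set (cochain n) :=
  [set f | forall t, coboundary f t = 0].

Definition coboundaries (n : nat) : set (cochain n) :=
  match n return set (cochain n) with
  | 0 => [set fun=> 0]
  | m.+1 => range (@coboundary m)
  end.

(* H-bar^n = [cocycles n] / closure of [coboundaries n] is not zero. *)
Definition reduced_cohomology_neq0 (n : nat) :=
  ~ (@cocycles n `<=` closure (@coboundaries n : set (cochain n))).

End ReducedCohomology.

Record subrepresentation (R : realType) (G : groupType) (V : hilbert R)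
    (s : unitary_rep G V) (W : set V) : Prop := Subrepresentation {
  subrep0 : W 0;
  subrepP : forall (a : R[i]) v w, W v -> W w -> W (a *: v + w);
  subrep_closed : closed W;
  subrep_stable : forall g v, W v -> W (s g v) }.

Definition finite_dimensional (R : realType) (V : hilbert R) (W : set V) :=
  exists (n : nat) (e : 'I_n -> V),
    W = [set v | exists c : 'I_n -> R[i], v = \sum_i c i *: e i].

Definition property_HFD (R : realType) (G : groupType) :=
  forall (V : hilbert R) (s : unitary_rep G V),
    reduced_cohomology_neq0 s 1 ->
    exists W : set V, [/\ subrepresentation s W, finite_dimensional W
                        & exists2 w, W w & w <> 0].

(* [T] is characterized, up to a unique compatible unitary, as the completion of
   the algebraic tensor product of [V] and [W] for
   <v (x) w, v' (x) w'> = <v, v'> <w, w'>. *)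
Record hilbert_tensor (R : realType) (V W : hilbert R) := HilbertTensor {
  tensor_space :> hilbert R;
  tens : {bilinear V -> W -> tensor_space};
  tens_dotp : forall v w v' w', dotp tensor_space (tens v w) (tens v' w') =
                                dotp V v v' * dotp W w w';
  tens_dense : dense [set x : tensor_space | exists n (v : 'I_n -> V) (w : 'I_n -> W),
                                x = \sum_i tens (v i) (w i)] }.

Record tensor_rep (R : realType) (G : groupType) (V W : hilbert R)
    (s : unitary_rep G V) (r : unitary_rep G W) := TensorRep {
  trep_space : hilbert_tensor V W;
  trep :> unitary_rep G trep_space;
  trepE : forall g v w,
    trep g (tens trep_space v w) = tens trep_space (s g v) (r g w) }.

Section ContinuousFunctions.
Variables (R : realType) (X : topologicalType).

Definition cfuns := continuousType X R[i]^o.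

Let cadd_continuous (f g : cfuns) : continuous (fun x => f x + g x : R[i]^o).
Proof. by move=> x; apply: cvgD; exact: cts_fun. Qed.

Let cscale_continuous (a : R[i]) (f : cfuns) :
  continuous (fun x => a * f x : R[i]^o).
Proof. by move=> x; apply: cvgM; [exact: cvg_cst | exact: cts_fun]. Qed.

Let cmul_continuous (f g : cfuns) : continuous (fun x => f x * g x : R[i]^o).
Proof. by move=> x; apply: cvgM; exact: cts_fun. Qed.

Let cconj_continuous (f : cfuns) : continuous (fun x => Num.conj (f x) : R[i]^o).
Proof.
move=> x; apply/cvgrPdist_lt => e e0.
have /cvgrPdist_lt/(_ e e0) := @cts_fun _ _ f x.
by apply: filterS => y; rewrite -[`|f x - f y|]norm_conjC rmorphB.
Qed.

Definition cfun1 : cfuns := cst 1.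
Definition cfunD (f g : cfuns) : cfuns := mkcts (@cadd_continuous f g).
Definition cfunZ (a : R[i]) (f : cfuns) : cfuns := mkcts (@cscale_continuous a f).
Definition cfunM (f g : cfuns) : cfuns := mkcts (@cmul_continuous f g).
Definition cfunC (f : cfuns) : cfuns := mkcts (@cconj_continuous f).

(* For X compact: the *-representations of C(X) by bounded operators, which are
   nondegenerate, i.e. unital. Without [crep1] the zero representation would make
   every orbit couple of compact second countable spaces faithful. *)
Record cfuns_rep (W : hilbert R) := CfunsRep {
  crep :> cfuns -> {linear W -> W};
  crep_bounded : forall f, continuous (crep f);
  crepD : forall f g w, crep (cfunD f g) w = crep f w + crep g w;
  crepZ : forall a f w, crep (cfunZ a f) w = a *: crep f w;
  crepM : forall f g w, crep (cfunM f g) w = crep f (crep g w);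
  crep1 : forall w, crep cfun1 w = w;
  crep_adj : forall f v w, dotp W (crep f v) w = dotp W v (crep (cfunC f) w) }.

End ContinuousFunctions.

(* The adjoint of the unitary [cov_G g] is written [cov_G g^-1]. *)
Record covariant_rep (R : realType) (G : groupType) (X : topologicalType)
    (S : dynamical_system G X) (W : hilbert R) := CovariantRep {
  cov_X : cfuns_rep X W;
  cov_G : unitary_rep G W;
  covP : forall (g : G) (f : cfuns R X) (w : W),
    cov_G g (cov_X f (cov_G g^-1%g w)) = cov_X (f \o S g^-1%g) w }.

Definition H1_faithful (R : realType) (G H : groupType) (O : orbit_couple G H) :=
  [/\ @second_countable (oc_X O), @second_countable (oc_Y O),
      compact [set: oc_X O], compact [set: oc_Y O]
    & forall (V : hilbert R) (s : unitary_rep G V),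
        reduced_cohomology_neq0 s 1 ->
        exists (W : hilbert R) (P : covariant_rep (oc_GX O) W)
               (T : tensor_rep s (cov_G P)), reduced_cohomology_neq0 T 1].

(* Main.v *)
Require Import Defs.
From HB Require Import structures.
From mathcomp Require Import all_boot all_order all_algebra.
From mathcomp Require Import complex.
From mathcomp Require Import all_classical all_reals all_analysis.
From mathcomp Require Import ring lra.

Set Implicit Arguments.
Unset Strict Implicit.
Unset Printing Implicit Defensive.

Import Order.TTheory GRing.Theory Num.Theory.
Import numFieldNormedType.Exports.

Local Open Scope classical_set_scope.
Local Open Scope ring_scope.
Local Open Scope complex_scope.

(* Let [L] be the tensor product of [s] with a covariant representation of [X]. The
   indicators of clopen sets of [X] act on [L], which turns [L] into the space of global
   sections of a [G]-equivariant sheaf on [X]. Pulling it back along [q : Y -> X], which is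
   a local homeomorphism with finite fibres, gives a unitary representation of [H];
   topological freeness makes [a] and [b] satisfy the cocycle identities this requires.
   Cocycles go from [G] to [H] by the same pullback, and back by pulling back along [p],
   and the round trip changes a cocycle by a coboundary, so the nonvanishing of reduced
   cohomology passes to [H]. Property H_FD then gives a finite-dimensional invariant
   subspace [F] of sections. The pullbacks along [p] of a Parseval frame of [F], with the
   second tensor factor traced out, define a nonzero [G]-invariant positive compact
   operator on the space of [s]; its top eigenspace is the required subrepresentation. *)

(** * Hilbert spaces *)

(** The cocycles map compact spaces to discrete groups, so each of them cuts [X] or [Y] into
    finitely many clopen pieces on which it is constant. Indicators of clopen sets therefore
    suffice, and sections are glued from finitely many vectors without measures or direct integrals.

    Two obstacles shape the rest. The map [q] need not be injective, so [L] itself is not the right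
    space for [H]; but [p (q y) = h(y) y] recovers [y] from [q y] and [h y], so [h], which takes
    finitely many values, separates the points of each fibre. And an element of [G] acts on pulled
    back sections through different elements [t] of [H] on different pieces, so the pullback of [F]
    need not be invariant in [L]. Each [t] only replaces a Parseval frame of [F] by another one,
    however, and sums of squares over a frame do not depend on the frame. Clopen projections touch
    only the second tensor factor, so tracing it out merges the pieces into an invariant form. *)

Section ComplexModulus.
Variable R : realType.
Implicit Types a b : R[i].

(** Norms over [R[i]] take values in [R[i]]. The squared modulus [csq] and the squared norm [nsq]
    live in [R], which keeps most estimates free of square roots. *)
Definition csq a : R := complex.Re a ^+ 2 + complex.Im a ^+ 2.

Lemma csqE a : `|a| ^+ 2 = (csq a)%:C.
Proof.
case: a => x y; rewrite normc_def /csq /= -rmorphXn /= sqr_sqrtr//.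
by rewrite addr_ge0 // sqr_ge0.
Qed.

Lemma csq_ge0 a : 0 <= csq a.
Proof. by rewrite addr_ge0 // sqr_ge0. Qed.

Lemma csq_eq0 a : csq a = 0 -> a = 0.
Proof.
move=> h; have := csqE a; rewrite h => /eqP.
by rewrite sqrf_eq0 normr_eq0 => /eqP.
Qed.

Lemma csqC (x : R) : csq x%:C = x ^+ 2.
Proof. by rewrite /csq /= expr0n addr0. Qed.

Lemma csqD a b : csq (a + b) <= 2 * csq a + 2 * csq b.
Proof.
case: a b => [x y] [z t]; rewrite /csq /=.
by have := sqr_ge0 (x - z); have := sqr_ge0 (y - t); lra.
Qed.

Lemma sqr_Re_le a : complex.Re a ^+ 2 <= csq a.
Proof. by rewrite /csq lerDl sqr_ge0. Qed.

Lemma ReD a b : complex.Re (a + b) = complex.Re a + complex.Re b.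
Proof. by case: a b => [x y] [z t]. Qed.

Lemma ReN a : complex.Re (- a) = - complex.Re a.
Proof. by case: a. Qed.

Lemma ReJ a : complex.Re (Num.conj a) = complex.Re a.
Proof. by case: a. Qed.

Lemma ReZ (x : R) a : complex.Re (x%:C * a) = x * complex.Re a.
Proof. by case: a => y z /=; rewrite mul0r subr0. Qed.

Lemma Re_iM a : complex.Re ('i%C * a) = - complex.Im a.
Proof. by case: a => y z /=; rewrite mul0r mul1r sub0r. Qed.

Lemma Re_sum I (r : seq I) (F : I -> R[i]) :
  complex.Re (\sum_(i <- r) F i) = \sum_(i <- r) complex.Re (F i).
Proof. by elim/big_rec2: _ => // i x y _ <-; rewrite ReD. Qed.

End ComplexModulus.

Section PreHilbert.
Variables (R : realType) (U : lmodType R[i]).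
Variable form : {dot U for (@Num.conj R[i])}.
Implicit Types u v w : U.

(** The form lives on a bare module, since these facts are also needed to put a norm on [dsum]. *)
Definition nsq u : R := complex.Re (form u u).

Lemma nsqE u : form u u = (nsq u)%:C.
Proof.
have /ger0_real/complex_realP [k kE] : 0 <= form u u by exact: dnorm_ge0.
by rewrite /nsq kE.
Qed.

Lemma nsq_ge0 u : 0 <= nsq u.
Proof.
by rewrite -lecR -nsqE; exact: dnorm_ge0.
Qed.

Lemma nsq0 : nsq 0 = 0.
Proof. by rewrite /nsq linear0r. Qed.

Lemma nsq_eq0 u : nsq u = 0 -> u = 0.
Proof. by move=> h; apply/eqP; rewrite -(dnorm_eq0 form) nsqE h. Qed.

Lemma nsqZ a u : nsq (a *: u) = csq a * nsq u.
Proof. by apply: complexI; rewrite rmorphM /= -!nsqE dnormZ csqE. Qed.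

Lemma nsqN u : nsq (- u) = nsq u.
Proof. by rewrite /nsq hnormN. Qed.

Lemma nsqD u v : nsq (u + v) = nsq u + nsq v + 2 * complex.Re (form u v).
Proof.
by rewrite /nsq dnormD !ReD ReJ; ring.
Qed.

Lemma nsqB u v : nsq (u - v) = nsq u + nsq v - 2 * complex.Re (form u v).
Proof. by rewrite nsqD nsqN linearNr ReN; ring. Qed.

Lemma nsq_para u v : nsq (u + v) + nsq (u - v) = 2 * nsq u + 2 * nsq v.
Proof. by rewrite nsqD nsqB; ring. Qed.

Lemma nsqD_le u v : nsq (u + v) <= 2 * nsq u + 2 * nsq v.
Proof. by rewrite -nsq_para lerDl nsq_ge0. Qed.

Lemma nsq_sum_le I (r : seq I) (F : I -> U) :
  nsq (\sum_(i <- r) F i) <= 2 ^+ size r * \sum_(i <- r) nsq (F i).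
Proof.
elim: r => [|i r ih]; first by rewrite !big_nil nsq0 mulr0.
rewrite !big_cons /= exprS.
apply: (le_trans (nsqD_le _ _)).
have h1 : 1 <= 2 ^+ size r :> R by rewrite exprn_ege1 // ler1n.
have h2 := nsq_ge0 (F i).
have h3 : 0 <= \sum_(j <- r) nsq (F j) by rewrite sumr_ge0 // => *; exact: nsq_ge0.
nra.
Qed.

Lemma dotpC u v : form v u = Num.conj (form u v).
Proof. by rewrite hermC /= mul1r. Qed.

Lemma dotpZl a u v : form (a *: u) v = a * form u v.
Proof. by rewrite linearZl_LR. Qed.

Lemma dotpZr a u v : form u (a *: v) = Num.conj a * form u v.
Proof. by rewrite linearZr_LR. Qed.

Lemma dotp_eq0C u v : form u v = 0 -> form v u = 0.
Proof. by rewrite (dotpC u v) => ->; rewrite rmorph0. Qed.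

(** For [a > 0] the right side of the hypothesis has minimum [- (b ^+ 2 / a)], attained at
    [- b / a]. *)
Lemma quadratic_ge (a b e : R) : 0 <= a -> (forall t, - e <= a * t ^+ 2 + 2 * b * t) ->
  b ^+ 2 <= e * a.
Proof.
move=> a0 h; have [a1|a1] := eqVneq a 0.
  rewrite a1 mulr0; have [-> |b0] := eqVneq b 0; first by rewrite expr0n.
  have e0 : 0 <= e by have := h 0; rewrite a1; lra.
  (* When [a = 0], a nonzero slope would produce the value [- (2 * (e + 1))], below [- e]. *)
  have := h (- (e + 1) / b); rewrite a1.
  have -> : 0 * (- (e + 1) / b) ^+ 2 + 2 * b * (- (e + 1) / b) = - (2 * (e + 1)).
    by field.
  lra.
have ap : 0 < a by rewrite lt_def a1 a0.
have := h (- b / a).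
have -> : a * (- b / a) ^+ 2 + 2 * b * (- b / a) = - (b ^+ 2 / a) by field.
by rewrite lerN2 ler_pdivrMr.
Qed.

Lemma csq_form_le u v : csq (form u v) <= nsq u * nsq v.
Proof.
have [-> |v0] := eqVneq v 0.
  by rewrite linear0r nsq0 mulr0 /csq /= expr0n addr0.
have nv : 0 < nsq v.
  rewrite lt_def nsq_ge0 andbT; apply: contra v0 => /eqP h.
  by rewrite (nsq_eq0 h).
set c := form u v.
(* This square expands to [nsq v * (nsq u * nsq v - csq c)]. *)
have := nsq_ge0 ((nsq v)%:C *: u - c *: v).
rewrite nsqB !nsqZ dotpZl dotpZr csqC -/c ReZ mulrC.
have -> : complex.Re (Num.conj c * c) = csq c.
  by rewrite mulrC -normCK csqE.
have := csq_ge0 c; have := nsq_ge0 u => h1 h2 h3.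
have h4 : 0 <= nsq v * (nsq u * nsq v - csq c) by lra.
by rewrite pmulr_rge0 // subr_ge0 in h4.
Qed.

End PreHilbert.

Notation norm2 := (nsq (dotp _)).

Section HilbertTopology.
Variables (R : realType) (V : hilbert R).
Implicit Types u v w : V.

Lemma sqr_normE v : `|v| ^+ 2 = (norm2 v)%:C.
Proof. by rewrite -dotp_norm nsqE. Qed.

Lemma norm_lt_sqr v (e : R) : 0 < e -> (`|v| < e%:C) = (norm2 v < e ^+ 2).
Proof.
move=> e0; rewrite -(ltr_pXn2r (ltn0Sn 1)) ?nnegrE ?normr_ge0 ?lecR ?ltW //.
by rewrite sqr_normE -rmorphXn /= ltcR.
Qed.

Lemma pos_complexE (e : R[i]) : 0 < e -> exists2 r : R, 0 < r & e = r%:C.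
Proof.
move=> e0; have /complex_realP [k kE] : e \is Num.real by rewrite ger0_real // ltW.
by exists k => //; rewrite -ltcR -kE.
Qed.

(** The radius is squared, so that density, closedness and completeness can be handled through
    [norm2] alone. *)
Lemma nbhs_norm2 v (A : set V) :
  nbhs v A <-> exists2 e : R, 0 < e & forall u, norm2 (v - u) < e -> A u.
Proof.
rewrite -nbhs_ballE /nbhs_ball_ /=; split=> [[e /= e0 h]|[e e0 h]].
  have [r r0 rE] := pos_complexE e0; exists (r ^+ 2); first by rewrite exprn_gt0.
  by move=> u hu; apply: h; rewrite -ball_normE /= rE norm_lt_sqr.
exists (Num.sqrt e)%:C => /=; first by rewrite ltcR sqrtr_gt0.
move=> u; rewrite -ball_normE /= norm_lt_sqr ?sqrtr_gt0 // sqr_sqrtr ?ltW //.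
exact: h.
Qed.

Lemma dense_norm2 (A : set V) v (e : R) : dense A -> 0 < e ->
  exists2 u, A u & norm2 (v - u) < e.
Proof.
move=> dA e0.
have [u [hu Au]] : A `&` [set u | norm2 (v - u) < e]^° !=set0.
  rewrite setIC; apply: dA; last exact: open_interior.
  by exists v; apply/nbhs_norm2; exists e.
by exists u => //; have /interior_subset := Au.
Qed.

Lemma closed_norm2 (W : set V) :
  (forall v, (forall e : R, 0 < e -> exists2 u, W u & norm2 (v - u) < e) -> W v) ->
  closed W.
Proof.
move=> h v cv; apply: h => e e0.
have [|u [Wu /= hu]] := cv [set u | norm2 (v - u) < e].
  by apply/nbhs_norm2; exists e.
by exists u.
Qed.

Lemma complete_norm2 (F : set_system V) : ProperFilter F ->
  (forall e : R, 0 < e -> exists2 A, F A & forall u v, A u -> A v -> norm2 (u - v) < e) ->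
  exists z, forall e : R, 0 < e -> F [set v | norm2 (z - v) < e].
Proof.
move=> PF h.
have cF : cauchy F.
  apply: cauchy_exP => e e0; have [r r0 rE] := pos_complexE e0.
  have [A FA hA] := h (r ^+ 2) (exprn_gt0 2 r0).
  have [u Au] := filter_ex FA; exists u.
  apply: filterS FA => v Av; rewrite -ball_normE /= rE norm_lt_sqr //.
  exact: hA.
have hz : F --> lim F := cauchy_cvg F cF.
by exists (lim F) => e e0; apply: hz; apply/nbhs_norm2; exists e.
Qed.

End HilbertTopology.

(** * The Riesz representation theorem on a closed subspace *)

Section Riesz.
Variables (R : realType) (V : hilbert R) (K : set V) (f : V -> R[i]) (C : R).
Hypotheses (K0 : K 0) (KP : forall (a : R[i]) v w, K v -> K w -> K (a *: v + w)).
Hypothesis K_closed :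
  forall v, (forall e : R, 0 < e -> exists2 u, K u & norm2 (v - u) < e) -> K v.
Hypothesis fP : forall (a : R[i]) v w, f (a *: v + w) = a * f v + f w.
Hypothesis f_bounded : forall v, csq (f v) <= C * norm2 v.

Let F v : R := norm2 v - 2 * complex.Re (f v).

Let f0 : f 0 = 0.
Proof. have := fP 0 0 0; rewrite scale0r add0r mul0r add0r => /eqP.
by have := fP 1 0 0; rewrite scale1r addr0 mul1r => /eqP; rewrite -subr_eq subrr eq_sym => /eqP.
Qed.

Let fD v w : f (v + w) = f v + f w.
Proof. by rewrite -[v]scale1r fP mul1r scale1r. Qed.

Let fZ a v : f (a *: v) = a * f v.
Proof. by rewrite -[a *: v]addr0 fP f0 addr0. Qed.

(** With [r = Re (f v)], [n = norm2 v] and [c] the modulus of [C]: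
    [(2 r)^2 <= 4 c n <= (n + c)^2]. *)
Let F_ge v : - `|C| <= F v.
Proof.
rewrite /F; have := f_bounded v; have := sqr_Re_le (f v); have := nsq_ge0 (dotp V) v.
move: (complex.Re _) (norm2 v) => r n n0 h1 h2.
have h3 : r ^+ 2 <= `|C| * n.
  by apply: (le_trans h1); apply: (le_trans h2); rewrite ler_wpM2r // ler_norm.
have c0 := normr_ge0 C; move: h3 c0; move: (`|C|) => c h3 c0.
have h4 : (2 * r) ^+ 2 <= (n + c) ^+ 2 by have := sqr_ge0 (n - c); lra.
have : 2 * r <= n + c.
  have [rn|rp] := leP r 0; first by lra.
  by move: h4; rewrite ler_pXn2r // ?nnegrE; lra.
lra.
Qed.

Let m := inf [set F v | v in K].

Let has_infF : has_inf [set F v | v in K].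
Proof.
split; first by exists (F 0), 0.
by exists (- `|C|) => _ [v _ <-]; exact: F_ge.
Qed.

Let F_ge_m v : K v -> m <= F v.
Proof. by move=> Kv; apply: ge_inf; [case: has_infF | exists v]. Qed.

Let Kapprox (e : R) := [set v | K v /\ F v < m + e].

(** The parallelogram law gives [F u + F v - 2 F ((u + v) / 2) = norm2 (u - v) / 2], and [F] is at
    least [m] at the midpoint. *)
Let Kapprox_cauchy e u v : Kapprox e u -> Kapprox e v -> norm2 (u - v) < 4 * e.
Proof.
move=> [Ku hu] [Kv hv].
have /F_ge_m : K ((2^-1)%:C *: (u + v)).
  rewrite -[X in K X]addr0; apply: KP => //.
  by rewrite -[u]scale1r; exact: KP.
have := nsq_para (dotp V) u v.
rewrite /F in hu hv *; rewrite fZ ReZ fD ReD nsqZ csqC expr2.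
move: (norm2 (u + v)) (norm2 (u - v)) => n1 n2.
lra.
Qed.

(** First variation of [F] at a near-minimizer: [F (t w + u) >= m] for all real [t] bounds the real
    part of the defect by a discriminant. Replacing [w] by [i w] bounds the imaginary part, whence
    the factor 2. *)
Let Kapprox_crit e u w : Kapprox e u -> K w ->
  csq (dotp V w u - f w) <= 2 * (e * norm2 w).
Proof.
move=> [Ku Fu] Kw.
have main w' : K w' -> complex.Re (dotp V w' u - f w') ^+ 2 <= e * norm2 w'.
  move=> Kw'; apply: quadratic_ge; first exact: nsq_ge0.
  move=> t; have /F_ge_m : K (t%:C *: w' + u) by exact: KP.
  rewrite /F in Fu *; rewrite nsqD fD fZ ReD ReZ dotpZl ReZ nsqZ csqC ReD ReN.
  move: (complex.Re _) (complex.Re _) (complex.Re _) Fu => a b c.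
  lra.
have h1 := main _ Kw.
have /main : K ('i%C *: w) by rewrite -[X in K X]addr0; exact: KP.
rewrite dotpZl fZ -mulrBr Re_iM nsqZ [csq 'i]/csq /= expr0n expr1n add0r mul1r sqrrN.
rewrite {1}/csq; move: h1; lra.
Qed.

(* The representing vector minimizes [norm2 v - 2 Re (f v)] on [K]. *)
Lemma riesz_subspace : exists2 z, K z & forall v, K v -> f v = dotp V v z.
Proof.
have Kne e : 0 < e -> Kapprox e !=set0.
  move=> e0; have [_ [v Kv <-] hv] := inf_adherent e0 has_infF.
  by exists v.
pose FF := filter_from [set e : R | 0 < e] Kapprox.
have PF : ProperFilter FF.
  apply: filter_from_proper; last by move=> e /= /Kne.
  apply: filter_from_filter; first by exists 1 => /=.
  move=> e1 e2 /= h1 h2; exists (Num.min e1 e2) => /=; first by rewrite lt_min h1.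
  move=> v [Kv Fv]; split; split=> //; apply: (lt_le_trans Fv);
    by rewrite lerD2l ge_min lexx ?orbT.
have [|z hz] := complete_norm2 PF.
  move=> e e0; exists (Kapprox (e / 4)).
    by exists (e / 4) => //=; rewrite divr_gt0.
  move=> u v hu hv; have := Kapprox_cauchy hu hv.
  by rewrite mulrC divfK // pnatr_eq0.
have ex e d : 0 < e -> 0 < d -> exists2 u, Kapprox d u & norm2 (z - u) < e.
  move=> e0 d0.
  have FA : FF (Kapprox d) by exists d.
  by have [u [? ?]] := filter_ex (filterI FA (hz _ e0)); exists u.
have Kz : K z.
  by apply: K_closed => e e0; have [u [Ku _] hu] := ex e 1 e0 ltr01; exists u.
exists z => // w Kw.
suff : csq (dotp V w z - f w) <= 0.
  move=> h; have /eqP : csq (dotp V w z - f w) = 0.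
    by apply/eqP; rewrite eq_le h csq_ge0.
  by move=> /eqP/csq_eq0/eqP; rewrite subr_eq0 => /eqP.
apply/ler_addgt0Pl => e e0; rewrite addr0.
(* The two parts of the splitting below contribute [2 * (d * norm2 w)] and [4 * (d * norm2 w)]. *)
pose d := e / (6 * (norm2 w + 1)).
have n0 : 0 < norm2 w + 1 by rewrite ltr_wpDl ?nsq_ge0.
have d0 : 0 < d by rewrite divr_gt0 // mulr_gt0.
have [u hu zu] := ex d d d0 d0.
have -> : dotp V w z - f w = dotp V w (z - u) + (dotp V w u - f w).
  by rewrite linearBr /=; ring.
apply: (le_trans (csqD _ _)).
have h1 := Kapprox_crit hu Kw.
have h2 := csq_form_le (dotp V) w (z - u).
have h3 : norm2 w * norm2 (z - u) <= norm2 w * d.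
  by rewrite ler_wpM2l ?nsq_ge0 // ltW.
have h4 : 6 * (norm2 w + 1) * d = e.
  by rewrite mulrC divfK // gt_eqF // mulr_gt0.
lra.
Qed.

End Riesz.

(** * Invariant compact forms *)

Section FiniteDimension.
Variables (R : realType) (V : hilbert R).

Lemma normalize (v : V) : v <> 0 -> exists2 a : R[i], a != 0 & norm2 (a *: v) = 1.
Proof.
move=> v0; have n0 : 0 < norm2 v.
  by rewrite lt_def nsq_ge0 andbT; apply/eqP => /nsq_eq0.
exists (Num.sqrt (norm2 v))^-1%:C.
  by rewrite fmorph_eq0 invr_eq0 gt_eqF // sqrtr_gt0.
by rewrite nsqZ csqC exprVn sqr_sqrtr ?nsq_ge0 // mulVf // gt_eqF.
Qed.

(** Each functional either vanishes on [W] or has a kernel of codimension one, so the induction adds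
    at most one spanning vector per functional. *)
Lemma finite_dimensional_functionals (W : set V) (z : seq V) :
  W 0 -> (forall (a : R[i]) v w, W v -> W w -> W (a *: v + w)) ->
  (forall v, W v -> (forall y, y \in z -> dotp V v y = 0) -> v = 0) ->
  finite_dimensional W.
Proof.
elim: z W => [|y z ih] W W0 WP Wz.
  exists 0%N, (fun=> 0); apply/seteqP; split=> [v Wv|v [c ->]] /=.
    by exists (fun=> 0); rewrite big_ord0; apply: Wz.
  by rewrite big_ord0.
have [h|] := pselect (forall v, W v -> dotp V v y = 0).
  apply: ih => // v Wv hv; apply: Wz => // y'.
  by rewrite in_cons => /predU1P [->|/hv //]; exact: h.
move=> /existsNP [e0] /not_implyP [We0 /eqP e0y].
pose W' := W `&` [set v | dotp V v y = 0].
have [||v []Wv vy hv|n [e W'E]] := ih W'.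
- by split=> //=; rewrite linear0l.
- move=> a v w [Wv vy] [Ww wy]; split; first exact: WP.
  by rewrite /= linearDl /= dotpZl; move: vy wy => /= -> ->; rewrite mulr0 addr0.
- by apply: Wz => // y'; rewrite in_cons => /predU1P [->|/hv].
exists n.+1, (fun i => if unlift ord0 i is Some j then e j else e0).
apply/seteqP; split=> [v Wv|v [c ->]] /=.
  pose a := dotp V v y / dotp V e0 y.
  have : W' (v - a *: e0).
    split; first by rewrite addrC -scaleNr; exact: WP.
    by rewrite /= linearBl /= dotpZl divfK // subrr.
  rewrite W'E => -[c vE].
  exists (fun i => if unlift ord0 i is Some j then c j else a).
  rewrite big_ord_recl unlift_none.
  under eq_bigr do rewrite liftK.
  by rewrite -vE addrC subrK.
rewrite big_ord_recl unlift_none.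
under eq_bigr do rewrite liftK.
apply: WP => //.
have : W' (\sum_(i < n) c (lift ord0 i) *: e i).
  by rewrite W'E; exists (fun i => c (lift ord0 i)).
by case.
Qed.

End FiniteDimension.

(** The supremum of [S] below is the limit of [f] along the ultrafilter. *)
Lemma ultra_oscillation (R : realType) (T : Type) (U : set_system T)
    (f : T -> R) (M : R) (B : set T) (d : R) :
  UltraFilter U -> U B -> (forall x, B x -> `|f x| <= M) -> 0 < d ->
  exists2 A, U A & forall x y, A x -> A y -> `|f x - f y| <= d.
Proof.
move=> UU UB fM d0.
pose S := [set t : R | U [set x | t <= f x]].
have hS : has_sup S.
  split.
    by exists (- M); apply: filterS UB => x /fM; rewrite ler_norml => /andP [].
  exists M => t St; have [x [Bx tx]] := filter_ex (filterI UB St).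
  by apply: (le_trans tx); apply: (le_trans (ler_norm _)); exact: fM.
have d2 : 0 < d / 2 by rewrite divr_gt0.
exists [set x | sup S - d / 2 <= f x < sup S + d / 2]; last first.
  by move=> x y /= /andP [h1 h2] /andP [h3 h4]; rewrite ler_norml; apply/andP; split; lra.
have h1 : U [set x | sup S - d / 2 <= f x].
  have [t St ht] := sup_adherent d2 hS.
  by apply: filterS St => x /= tx; apply: ltW; apply: (lt_le_trans ht).
have h2 : U [set x | f x < sup S + d / 2].
  have [h|h] := in_ultra_setVsetC [set x | f x < sup S + d / 2] UU => //.
  have : S (sup S + d / 2).
    by apply: filterS h => x /= /negP; rewrite -leNgt.
  by move=> /(ub_le_sup hS.2); rewrite gerDl leNgt d2.
by apply: filterS2 h1 h2 => x /= -> ->.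
Qed.

(** This is what is needed of the weak compactness of the unit ball: an ultrafilter on it is weakly
    Cauchy. *)
Lemma ultra_functionals (R : realType) (V : hilbert R) (U : set_system V)
    (z : seq V) (d : R) :
  UltraFilter U -> U [set v | norm2 v <= 1] -> 0 < d ->
  exists2 A, U A & forall u v, A u -> A v ->
    forall y, y \in z -> csq (dotp V (u - v) y) <= d.
Proof.
move=> UU UB d0; elim: z => [|y z [A UA hA]]; first by exists setT; [exact: filterT|].
(* The real and the imaginary part each contribute [e ^+ 2 <= e <= d / 2]. *)
pose e := Num.min 1 (d / 2).
have e0 : 0 < e by rewrite lt_min ltr01 divr_gt0.
have bd v : norm2 v <= 1 -> csq (dotp V v y) <= (norm2 y + 1) ^+ 2.
  move=> v1; apply: (le_trans (csq_form_le _ _ _)).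
  have := nsq_ge0 (dotp V) y; have := nsq_ge0 (dotp V) v => h1 h2.
  by nra.
have n1 : 0 <= norm2 y + 1 by rewrite addr_ge0 // nsq_ge0.
have bdr v (x : R) : norm2 v <= 1 -> x ^+ 2 <= csq (dotp V v y) -> `|x| <= norm2 y + 1.
  move=> v1 hx; rewrite -(ler_pXn2r (ltn0Sn 1)) ?nnegrE //.
  by rewrite -normrX ger0_norm ?sqr_ge0 //; apply: (le_trans hx); exact: bd.
have [A1 UA1 h1] := @ultra_oscillation R V U (fun v => complex.Re (dotp V v y)) _ _ e
  UU UB (fun v v1 => bdr v _ v1 (sqr_Re_le _)) e0.
have im_le (a : R[i]) : complex.Im a ^+ 2 <= csq a by rewrite /csq lerDr sqr_ge0.
have [A2 UA2 h2] := @ultra_oscillation R V U (fun v => complex.Im (dotp V v y)) _ _ e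
  UU UB (fun v v1 => bdr v _ v1 (im_le _)) e0.
exists (A `&` (A1 `&` A2)); first by apply: filterI => //; exact: filterI.
move=> u v [Au [A1u A2u]] [Av [A1v A2v]] y'.
rewrite in_cons => /predU1P [->|]; last exact: hA.
have {h1} := h1 u v A1u A1v; have {h2} := h2 u v A2u A2v.
rewrite linearBl /=; case: (dotp V u y) (dotp V v y) => [a b] [a' b'] /=.
have sq (x : R) : `|x| <= e -> x ^+ 2 <= d / 2.
  move=> hx; rewrite -real_normK ?num_real //.
  have e1 : e <= 1 by rewrite ge_min lexx.
  have e2 : e <= d / 2 by rewrite ge_min lexx orbT.
  have := normr_ge0 x; nra.
by rewrite /csq /= => /sq h1 /sq h2; lra.
Qed.

(** * The top eigenspace of an invariant compact positive form *)

Section CompactForm.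
Variables (R : realType) (G : groupType) (V : hilbert R) (s : unitary_rep G V).
Variables (q : V -> R) (C : R).
Hypothesis q_para : forall v w, q (v + w) + q (v - w) = 2 * q v + 2 * q w.
Hypothesis q_ge0 : forall v, 0 <= q v.
Hypothesis qZ : forall a v, q (a *: v) = csq a * q v.
Hypothesis q_le : forall v, q v <= C * norm2 v.
Hypothesis q_inv : forall g v, q (s g v) = q v.
(** Compactness, phrased as weak continuity at 0 on bounded sets. The bound 4 is that of [norm2] on
    differences of vectors of the unit ball. *)
Hypothesis q_compact : forall e : R, 0 < e -> exists (z : seq V) (d : R), 0 < d /\
  forall v, norm2 v <= 4 -> (forall y, y \in z -> csq (dotp V v y) <= d) -> q v <= e.
Hypothesis q_neq0 : exists v, q v <> 0.

Let S := [set q v | v in [set v | norm2 v <= 1]].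
Let l := sup S.

Let q0 : q 0 = 0.
Proof. by rewrite -(scale0r 0) qZ /csq /= expr0n addr0 mul0r. Qed.

Let hS : has_sup S.
Proof.
split; first by exists (q 0), 0 => //=; rewrite nsq0 ler01.
exists `|C| => _ [v /= v1 <-]; apply: (le_trans (q_le v)).
apply: (@le_trans _ _ (`|C| * norm2 v)); first by rewrite ler_wpM2r ?nsq_ge0 // ler_norm.
by rewrite ler_piMr.
Qed.

Let q_le_l v : q v <= l * norm2 v.
Proof.
have [->|/eqP v0] := eqVneq v 0; first by rewrite q0 nsq0 mulr0.
have [a a0 av] := normalize v0.
have h : q (a *: v) <= l by apply: (ub_le_sup hS.2); exists (a *: v) => //=; rewrite av.
have cp : 0 < csq a.
  by rewrite lt_def csq_ge0 andbT; apply: contra a0 => /eqP/csq_eq0 ->.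
rewrite -(ler_pM2l cp) -qZ; apply: (le_trans h).
by rewrite mulrCA -nsqZ av mulr1.
Qed.

Let l_gt0 : 0 < l.
Proof.
have [v /eqP qv] := q_neq0; have qp : 0 < q v by rewrite lt_def qv q_ge0.
have := lt_le_trans qp (q_le_l v).
have := nsq_ge0 (dotp V) v; rewrite le_eqVlt => /predU1P [<-|n0].
  by rewrite mulr0 ltxx.
by rewrite pmulr_lgt0.
Qed.

(** The form of [l - A], where [A] is the operator of [q]. As it is nonnegative, its zeros form the
    eigenspace of [l]; the parallelogram law replaces any use of [A] itself. *)
Let P v := l * norm2 v - q v.

Let P_ge0 v : 0 <= P v.
Proof. by rewrite subr_ge0. Qed.

Let PD v w : P (v + w) + P (v - w) = 2 * P v + 2 * P w.
Proof.
rewrite /P; have := q_para v w; have := nsq_para (dotp V) v w.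
move: (norm2 (v + w)) (norm2 (v - w)) => a b h1 h2.
have -> : a = 2 * norm2 v + 2 * norm2 w - b by rewrite -h1; ring.
have -> : q (v + w) = 2 * q v + 2 * q w - q (v - w) by rewrite -h2; ring.
by ring.
Qed.

Let PD_le v w : P (v + w) <= 2 * P v + 2 * P w.
Proof. by rewrite -PD lerDl. Qed.

Let PB_le v w : P (v - w) <= 2 * P v + 2 * P w.
Proof. by rewrite -PD lerDr. Qed.

Let PZ a v : P (a *: v) = csq a * P v.
Proof. by rewrite /P qZ nsqZ; ring. Qed.

Let E := [set v | P v = 0].

Let E0 : E 0.
Proof. by rewrite /E /= /P q0 nsq0 mulr0 subr0. Qed.

Let EP (a : R[i]) v w : E v -> E w -> E (a *: v + w).
Proof.
rewrite /E /= => v0 w0; apply/eqP; rewrite eq_le P_ge0 andbT.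
by apply: (le_trans (PD_le _ _)); rewrite PZ v0 w0 !mulr0 addr0.
Qed.

Let P_limit v : (forall e : R, 0 < e -> exists2 u, P u < e & norm2 (v - u) < e) -> P v = 0.
Proof.
move=> h; apply/eqP; rewrite eq_le P_ge0 andbT.
apply/ler_addgt0Pl => e e0; rewrite addr0.
have d0 : 0 < e / (2 * (l + 1)) by rewrite divr_gt0 // mulr_gt0 // addr_gt0.
have [u Pu uv] := h _ d0.
rewrite -(subrK u v); apply: (le_trans (PD_le _ _)).
have h1 : P (v - u) <= l * norm2 (v - u) by rewrite /P gerBl.
have h2 : l * norm2 (v - u) <= l * (e / (2 * (l + 1))) by rewrite ler_pM2l // ltW.
have h3 : 2 * (l + 1) * (e / (2 * (l + 1))) = e.
  by rewrite mulrC divfK // gt_eqF // mulr_gt0 // addr_gt0.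
lra.
Qed.

(** Along an ultrafilter of maximizing vectors, [P] of a difference is small by the parallelogram
    law and [q] of it is small by weak smallness. Since [l * norm2 = P + q], the ultrafilter is
    Cauchy in norm. *)
Let E_neq0 : exists2 w, E w & w <> 0.
Proof.
pose A (e : R) := [set v | norm2 v <= 1 /\ l - e < q v].
pose FF := filter_from [set e : R | 0 < e] A.
have PF : ProperFilter FF.
  apply: filter_from_proper; last first.
    by move=> e /= e0; have [_ [v v1 <-] hv] := sup_adherent e0 hS; exists v.
  apply: filter_from_filter; first by exists 1 => /=.
  move=> e1 e2 /= h1 h2; exists (Num.min e1 e2) => /=; first by rewrite lt_min h1.
  move=> v [v1 qv]; split; split=> //; apply: le_lt_trans qv;
    by rewrite lerD2l lerN2 ge_min lexx ?orbT.
have [U [UU FU]] := @ultraFilterLemma V FF PF.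
have UA e : 0 < e -> U (A e) by move=> e0; apply: FU; exists e.
have U1 : U [set v | norm2 v <= 1] by apply: filterS (UA 1 ltr01) => v [].
have PA e v : A e v -> P v < e.
  move=> [v1 qv]; rewrite /P; have : l * norm2 v <= l by rewrite ler_piMr // ltW.
  lra.
have [|z hz] := @complete_norm2 _ _ U _.
  move=> e e0; have e1 : 0 < l * e / 16 by rewrite divr_gt0 // mulr_gt0.
  have [zs [d [d0 hd]]] := q_compact e1.
  have [B UB hB] := ultra_functionals zs UU U1 d0.
  exists (B `&` A (l * e / 16)); first by apply: filterI => //; exact: UA.
  move=> u v [Bu Au] [Bv Av].
  have n4 : norm2 (u - v) <= 4.
    have := nsqD_le (dotp V) u (- v); rewrite nsqN.
    by move: Au.1 Av.1; lra.
  rewrite -(ltr_pM2l l_gt0); have := hd _ n4 (hB _ _ Bu Bv).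
  have := PB_le u v; move: (PA _ _ Au) (PA _ _ Av).
  rewrite {3}/P.
  have : 0 < l * e by rewrite mulr_gt0.
  lra.
have ex e : 0 < e -> exists2 u, A e u & norm2 (z - u) < e.
  by move=> e0; have [u [? ?]] := filter_ex (filterI (UA _ e0) (hz _ e0)); exists u.
exists z.
  by apply: P_limit => e /ex [u /PA Pu uz]; exists u.
(* If [z = 0], a nearby [u] would satisfy both [q u > l / 2] and [q u <= l * norm2 u < l / 2]. *)
move=> z0; have [|u [_ qu]] := ex (Num.min (l / 2) 2^-1).
  by rewrite lt_min divr_gt0 //= invr_gt0.
rewrite z0 sub0r nsqN lt_min => /andP [_ un].
have h1 : Num.min (l / 2) 2^-1 <= l / 2 by rewrite ge_min lexx.
have h2 := q_le_l u.
have h3 : l * norm2 u < l * 2^-1 by rewrite ltr_pM2l.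
by clear z0; lra.
Qed.

(* The top eigenspace of the compact operator with quadratic form [q]. *)
Lemma compact_form_subrep : exists W : set V,
  [/\ subrepresentation s W, finite_dimensional W & exists2 w, W w & w <> 0].
Proof.
exists E; split; [split=> // | | exact: E_neq0].
- apply: closed_norm2 => v h; apply: P_limit => e e0.
  by have [u Eu uv] := h e e0; exists u => //; rewrite Eu.
- by move=> g v; rewrite /E /= /P q_inv /nsq urep_dotp.
(* A unit vector of [E] has [q = l], whereas [q <= l / 2] on unit vectors orthogonal to [z]; so the
   functionals of [z] separate [E]. *)
have l2 : 0 < l / 2 by rewrite divr_gt0.
have [z [d [d0 hd]]] := q_compact l2.
apply: (finite_dimensional_functionals (z := z)) => // v Ev hv.
apply: contrapT => v0; have [a a0 av] := normalize v0.
have : q (a *: v) <= l / 2.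
  apply: hd; first by rewrite av ler1n.
  by move=> y /hv h; rewrite dotpZl h mulr0 /csq /= expr0n addr0 ltW.
have : E (a *: v) by rewrite -[a *: v]addr0; exact: EP.
by rewrite /E /= /P av; move: l_gt0; lra.
Qed.

End CompactForm.

(** * Frames and direct sums *)

Section Frames.
Variables (R : realType) (V : hilbert R).

(* Parseval frames replace orthonormal bases: linear independence is never needed. *)
Definition frame (W : set V) (o : seq V) :=
  (forall x, x \in o -> W x) /\ (forall v, W v -> v = \sum_(x <- o) dotp V v x *: x).

(** Gram-Schmidt: the residue [r] of a further spanning vector is zero and adds nothing, or it is
    normalized and adjoined. *)
Lemma frame_exists (W : set V) : finite_dimensional W -> exists fr, frame W fr.
Proof.
move=> [n [e ->]]; elim: n e => [|n ih] e.
  exists [::]; split=> // v [c ->]; by rewrite big_ord0 big_nil.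
pose e' i := e (lift ord0 i).
have [fr [Wf Ef]] := ih e'; set W' := [set v | _] in Wf Ef.
have W'P (a : R[i]) v w : W' v -> W' w -> W' (a *: v + w).
  move=> [c ->] [c' ->]; exists (fun i => a * c i + c' i).
  by rewrite scaler_sumr -big_split /=; apply: eq_bigr => i _; rewrite scalerDl scalerA.
have W'0 : W' 0 by exists (fun=> 0); rewrite big1 // => i _; rewrite scale0r.
have W'sum (f : V -> R[i]) : W' (\sum_(x <- fr) f x *: x).
  by rewrite big_seq; elim/big_rec: _ => // x y /Wf xW; exact: W'P.
have WE v : (exists c, v = \sum_(i < n.+1) c i *: e i) <->
    exists a w, W' w /\ v = w + a *: e ord0.
  split=> [[c ->]|[a [w [[c ->] ->]]]].
    exists (c ord0), (\sum_(i < n) c (lift ord0 i) *: e' i).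
    by rewrite big_ord_recl addrC; split=> //; exists (fun i => c (lift ord0 i)).
  exists (fun i => if unlift ord0 i is Some j then c j else a).
  rewrite big_ord_recl unlift_none addrC.
  by under [in RHS]eq_bigr do rewrite liftK.
pose r := e ord0 - \sum_(x <- fr) dotp V (e ord0) x *: x.
have rW w : W' w -> dotp V r w = 0.
  move=> Ww; rewrite linearBl /= linear_sumlz [in X in X - _](Ef _ Ww) linear_sumr /=.
  rewrite -sumrB big1 // => x _; rewrite dotpZl dotpZr -dotpC mulrC; ring.
have [r0|/eqP r0] := eqVneq r 0.
  have eW : W' (e ord0) by move/eqP: r0; rewrite subr_eq0 => /eqP ->; exact: W'sum.
  exists fr; split=> [x /Wf xW|v /= /WE [a [w [Ww ->]]]].
    by apply/WE; exists 0, x; rewrite scale0r addr0.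
  by apply: Ef; rewrite addrC; exact: W'P.
have [b b0 br] := normalize r0; pose u := b *: r.
have uu : dotp V u u = 1 by rewrite nsqE br.
have uW w : W' w -> dotp V u w = 0 by move=> Ww; rewrite dotpZl rW // mulr0.
exists (u :: fr); split=> [x|v].
  rewrite in_cons => /predU1P [->|/Wf xW]; apply/WE.
    exists b, (- b *: \sum_(x <- fr) dotp V (e ord0) x *: x + 0).
    split; first by apply: W'P.
    by rewrite addr0 /u /r scalerBr scaleNr addrC.
  by exists 0, x; rewrite scale0r addr0.
move=> /WE [a [w [Ww ->]]].
pose w' := a *: (\sum_(x <- fr) dotp V (e ord0) x *: x) + w.
have w'W : W' w' by exact: W'P.
have vE : w + a *: e ord0 = w' + (a / b) *: u.
  rewrite /u scalerA divfK // /w' /r scalerBr [_ + w]addrC -addrA; congr (_ + _).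
  by rewrite addrC subrK.
clearbody w' u; rewrite vE big_cons linearDl /= dotpZl uu mulr1 (dotp_eq0C (uW _ w'W)) add0r addrC.
congr (_ + _); rewrite {1}(Ef _ w'W) big_seq [RHS]big_seq; apply: eq_bigr => x xo.
by rewrite linearDl /= dotpZl uW ?mulr0 ?add0r //; exact: Wf.
Qed.

(** Both sides are the squared Hilbert-Schmidt norm of [f] on [W]: expanding each frame in the other
    leads to the same double sum. *)
Lemma frame_norm2 (K : hilbert R) (W : set V) (fr fr' : seq V) (f : V -> K) :
  frame W fr -> frame W fr' -> (forall a v w, f (a *: v + w) = a *: f v + f w) ->
  \sum_(x <- fr) norm2 (f x) = \sum_(x <- fr') norm2 (f x).
Proof.
move=> [Wf Ef] [Wf' Ef'] fP.
have f0 : f 0 = 0.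
  by have := fP (- 1) 0 0; rewrite scaler0 addr0 scaleN1r addNr.
have fsum (r : seq V) (c : V -> R[i]) :
    f (\sum_(x <- r) c x *: x) = \sum_(x <- r) c x *: f x.
  by elim: r => [|x r ih]; rewrite ?big_nil // !big_cons fP ih.
apply: complexI; rewrite !rmorph_sum /=.
transitivity (\sum_(x <- fr) \sum_(y <- fr') dotp V x y * dotp K (f y) (f x)).
  rewrite big_seq [RHS]big_seq; apply: eq_bigr => x /Wf xW.
  rewrite -nsqE {1}(Ef' _ xW) fsum linear_sumlz.
  by apply: eq_bigr => y _; rewrite /= dotpZl.
rewrite exchange_big /= big_seq [RHS]big_seq; apply: eq_bigr => y /Wf' yW.
rewrite -nsqE [in X in _ = dotp K _ X](Ef _ yW) fsum linear_sumr.
by apply: eq_bigr => x _; rewrite /= dotpZr -dotpC.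
Qed.

End Frames.

Lemma nsq_triangle (R : realType) (U : lmodType R[i])
    (form : {dot U for (@Num.conj R[i])}) u v :
  Num.sqrt (nsq form (u + v)) <= Num.sqrt (nsq form u) + Num.sqrt (nsq form v).
Proof.
set a := Num.sqrt (nsq form u); set b := Num.sqrt (nsq form v).
have a0 : 0 <= a := sqrtr_ge0 _; have b0 : 0 <= b := sqrtr_ge0 _.
rewrite -[leRHS]ger0_norm ?addr_ge0 // -sqrtr_sqr ler_sqrt ?sqr_ge0 //.
have aE : nsq form u = a ^+ 2 by rewrite sqr_sqrtr ?nsq_ge0.
have bE : nsq form v = b ^+ 2 by rewrite sqr_sqrtr ?nsq_ge0.
rewrite nsqD sqrrD aE bE.
have : complex.Re (form u v) <= a * b.
  rewrite -[leRHS]ger0_norm ?mulr_ge0 // -sqrtr_sqr.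
  apply: (le_trans (ler_norm _)); rewrite -sqrtr_sqr ler_sqrt ?sqr_ge0 //.
  by rewrite exprMn -aE -bE; apply: (le_trans (sqr_Re_le _)); exact: csq_form_le.
by rewrite mulr2n; lra.
Qed.

(** The index type will be the group [H], possibly infinite; [fam_supp] keeps the direct sum finite,
    and [fam_closed] makes it complete. *)
Record subspace_family (R : realType) (L : hilbert R) (T : eqType) := SubspaceFamily {
  fam :> T -> set L;
  fam_supp : seq T;
  fam0 : forall t, fam t 0;
  famP : forall t (a : R[i]) v w, fam t v -> fam t w -> fam t (a *: v + w);
  fam_closed : forall t v,
    (forall e : R, 0 < e -> exists2 u, fam t u & norm2 (v - u) < e) -> fam t v;
  fam_out : forall t v, t \notin fam_supp -> fam t v -> v = 0 }.

Definition fam_pred (R : realType) (L : hilbert R) (T : eqType)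
  (D : subspace_family L T) : {pred (T -> L)} := fun x => `[< forall t, D t (x t) >].

Section DirectSum.
Variables (R : realType) (L : hilbert R) (T : eqType) (D : subspace_family L T).

Let fam_submod : submod_closed (fam_pred D).
Proof.
split; first by apply/asboolP => t; exact: fam0.
by move=> a x y /asboolP hx /asboolP hy; apply/asboolP => t; exact: famP.
Qed.

HB.instance Definition _ := GRing.isSubmodClosed.Build _ _ (fam_pred D) fam_submod.

Record dsum := Dsum { dsum_val :> T -> L; dsum_subproof : dsum_val \in fam_pred D }.

HB.instance Definition _ := [isSub for dsum_val].
HB.instance Definition _ := gen_eqMixin dsum.
HB.instance Definition _ := gen_choiceMixin dsum.
HB.instance Definition _ := [SubChoice_isSubLmodule of dsum by <:].

Lemma dsumP (x : dsum) t : D t (x t).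
Proof. by have /asboolP := dsum_subproof x; apply. Qed.

Lemma dsum_ext (x y : dsum) : (forall t, x t = y t) -> x = y.
Proof. by move=> h; apply: val_inj; apply/funext. Qed.

Lemma dsumB (x y : dsum) t : (x - y) t = x t - y t.
Proof. by []. Qed.

Definition mk_dsum (x : T -> L) (h : forall t, D t (x t)) : dsum :=
  @Dsum x (asboolT h).

Lemma dsum_out (x : dsum) t : t \notin fam_supp D -> x t = 0.
Proof. by move=> /fam_out; apply; exact: dsumP. Qed.

Definition dsum_dot (x y : dsum) : R[i] :=
  \sum_(t <- undup (fam_supp D)) dotp L (x t) (y t).

Let dsum_dot_bilinear :
  bilinear_for (GRing.Scale.Law.clone _ _ *%R _)
    (GRing.Scale.Law.clone _ _ (@Num.conj R[i] \; *%R) _) dsum_dot.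
Proof.
split=> [y|x] a u v; rewrite /dsum_dot /= mulr_sumr -big_split; apply: eq_bigr => t _ /=.
  by rewrite linearDl /= dotpZl.
by rewrite linearDr /= dotpZr.
Qed.

HB.instance Definition _ := bilinear_isBilinear.Build _ _ _ _ _ _ _ dsum_dot_bilinear.

Let dsum_dot_hermitian x y :
  dsum_dot x y = (-1) ^+ false * Num.conj (dsum_dot y x).
Proof.
rewrite expr0 mul1r rmorph_sum /=; apply: eq_bigr => t _; exact: dotpC.
Qed.

HB.instance Definition _ :=
  isHermitianSesquilinear.Build _ _ false (@Num.conj R[i]) dsum_dot dsum_dot_hermitian.

Let dsum_dot_gt0 x : x != 0 -> 0 < dsum_dot x x.
Proof.
move=> x0; rewrite lt_def; apply/andP; split; last first.
  by apply: sumr_ge0 => t _; exact: dnorm_ge0.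
apply: contra x0; rewrite psumr_eq0; last by move=> t _; exact: dnorm_ge0.
move=> /allP h; apply/eqP/dsum_ext => t.
have [ts|ts] := boolP (t \in undup (fam_supp D)).
  by have := h t ts; rewrite /= dnorm_eq0 => /eqP ->.
by rewrite dsum_out // -mem_undup.
Qed.

HB.instance Definition _ := isDotProduct.Build _ _ dsum_dot dsum_dot_gt0.

Definition dsum_norm (x : dsum) : R[i] := (Num.sqrt (nsq dsum_dot x))%:C.

Let dsum_normD x y : dsum_norm (x + y) <= dsum_norm x + dsum_norm y.
Proof. by rewrite -rmorphD lecR; exact: nsq_triangle. Qed.

Let dsum_normZ (a : R[i]) x : dsum_norm (a *: x) = `|a| * dsum_norm x.
Proof.
rewrite /dsum_norm nsqZ sqrtrM ?csq_ge0 // rmorphM; congr (_ * _).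
by case: a => b c; rewrite normc_def.
Qed.

Let dsum_norm0 x : dsum_norm x = 0 -> x = 0.
Proof.
move=> /eqP; rewrite fmorph_eq0 sqrtr_eq0 => h.
by apply/(@nsq_eq0 _ _ dsum_dot)/eqP; rewrite eq_le h nsq_ge0.
Qed.

HB.instance Definition _ :=
  Lmodule_isNormed.Build R[i] dsum dsum_normD dsum_normZ dsum_norm0.

Lemma dsum_normE (x : dsum) : `|x| = (Num.sqrt (nsq dsum_dot x))%:C.
Proof. by []. Qed.

Lemma nsq_dsum (x : dsum) :
  nsq dsum_dot x = \sum_(t <- undup (fam_supp D)) norm2 (x t).
Proof. exact: Re_sum. Qed.

Lemma norm2_dsum_le (x : dsum) t : norm2 (x t) <= nsq dsum_dot x.
Proof.
rewrite nsq_dsum; have [ts|ts] := boolP (t \in undup (fam_supp D)).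
  rewrite (bigD1_seq t) ?undup_uniq //= lerDl sumr_ge0 // => *; exact: nsq_ge0.
rewrite dsum_out ?nsq0 ?sumr_ge0 // => [*|]; first exact: nsq_ge0.
by rewrite -mem_undup.
Qed.

Let dsum_norm_lt (x : dsum) (e : R) : 0 < e ->
  (`|x| < e%:C) = (nsq dsum_dot x < e ^+ 2).
Proof.
move=> e0; rewrite dsum_normE ltcR -[X in _ < X]ger0_norm ?ltW // -sqrtr_sqr.
by rewrite ltr_sqrt // exprn_gt0.
Qed.

Let dsum_ball (x y : dsum) (e : R) : 0 < e ->
  ball x e%:C y <-> nsq dsum_dot (x - y) < e ^+ 2.
Proof. by move=> e0; rewrite -dsum_norm_lt // -[ball _ _ _]/(ball_ Num.norm _ _ _). Qed.

Let dsum_complete (F : set_system dsum) : ProperFilter F -> cauchy F -> cvg F.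
Proof.
move=> PF /cauchyP cF.
have Ft t : exists z, forall e : R, 0 < e -> F [set x | norm2 (z - x t) < e].
  have PFt : ProperFilter (fmap (fun x : dsum => x t) F) by exact: fmap_proper_filter.
  apply: (complete_norm2 PFt) => e e0.
  have e4 : 0 < Num.sqrt (e / 4) by rewrite sqrtr_gt0 divr_gt0.
  have [|x Fx] := cF (Num.sqrt (e / 4))%:C; first by rewrite ltcR.
  exists [set v | norm2 (x t - v) < e / 4].
    rewrite -[fmap _ _ _]/(F [set y : dsum | norm2 (x t - y t) < e / 4]).
    apply: filterS Fx => y /(proj1 (@dsum_ball x y _ e4)).
    rewrite sqr_sqrtr ?divr_ge0 ?ltW // => /(le_lt_trans _); apply.
    by rewrite -dsumB; exact: norm2_dsum_le.
  move=> u v /= hu hv.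
  have -> : u - v = - (x t - u) + (x t - v) by rewrite opprB addrA subrK.
  have := nsqD_le (dotp L) (- (x t - u)) (x t - v); rewrite nsqN.
  lra.
have [z hz] := choice Ft.
have zD t : D t (z t).
  apply: fam_closed => e e0; have [x xe] := filter_ex (hz t e e0).
  by exists (x t) => //; exact: dsumP.
apply/cvg_ex; exists (mk_dsum zD) => A.
rewrite -nbhs_ballE => -[e /= e0 hA]; apply: filterS hA _.
have [r r0 rE] := pos_complexE e0.
(* The successor makes the final bound strict and covers an empty support. *)
set s := undup (fam_supp D); pose d := r ^+ 2 / (size s).+1%:R.
have d0 : 0 < d by rewrite divr_gt0 ?exprn_gt0.
have : F [set x | forall t, t \in s -> norm2 (z t - x t) < d].
  elim: (s) => [|t s' ih]; first exact: filterE.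
  apply: filterS2 ih (hz t d d0) => x /= hx ht t'.
  by rewrite in_cons => /predU1P [->|/hx].
apply: filterS => x hx; rewrite rE; apply/(@dsum_ball _ x _ r0).
rewrite nsq_dsum -/s.
apply: (@le_lt_trans _ _ (\sum_(t <- s) d)).
  rewrite big_seq [leRHS]big_seq; apply: ler_sum => t /hx/ltW; apply: le_trans.
  by rewrite dsumB.
rewrite big_const_seq count_predT iter_addr_0.
have -> : r ^+ 2 = d *+ (size s).+1 by rewrite -mulr_natr divfK.
by rewrite mulrSr ltrDl.
Qed.

HB.instance Definition _ := Uniform_isComplete.Build dsum dsum_complete.

Let dsum_dot_norm x : dsum_dot x x = `|x| ^+ 2.
Proof. by rewrite dsum_normE -rmorphXn /= sqr_sqrtr ?nsq_ge0 // -nsqE. Qed.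

Definition dsum_hilbert : hilbert R := Hilbert dsum_dot_norm.

End DirectSum.

(** * Tensor products and clopen projections *)

Lemma dotp_closed (R : realType) (V : hilbert R) (t u : V) :
  (forall e : R, 0 < e -> exists2 u', dotp V u' t = 0 & norm2 (u - u') < e) ->
  dotp V u t = 0.
Proof.
move=> h; apply: csq_eq0; apply/eqP; rewrite eq_le csq_ge0 andbT.
apply/ler_addgt0Pl => e e0; rewrite addr0.
have n0 : 0 < norm2 t + 1 by rewrite ltr_wpDl ?nsq_ge0.
have [u' u't uu'] := h (e / (norm2 t + 1)) (divr_gt0 e0 n0).
have -> : dotp V u t = dotp V (u - u') t by rewrite linearBl /= u't subr0.
apply: (le_trans (csq_form_le _ _ _)).
move: uu'; rewrite ltr_pdivlMr // => uu'; apply: le_trans (ltW uu').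
by rewrite ler_wpM2l ?nsq_ge0 // lerDl.
Qed.

Section Tensor.
Variables (R : realType) (V W : hilbert R) (T : hilbert_tensor V W).
Implicit Types (v : V) (w : W) (u : T).

Lemma norm2_tens v w : norm2 (tens T v w) = norm2 v * norm2 w.
Proof. by apply: complexI; rewrite rmorphM /= -!nsqE tens_dotp. Qed.

Lemma tensZl a v w : tens T (a *: v) w = a *: tens T v w.
Proof. by rewrite linearZl_LR. Qed.

Lemma tensZr a v w : tens T v (a *: w) = a *: tens T v w.
Proof. by rewrite linearZr_LR. Qed.

Lemma tensor_approx u (e : R) : 0 < e -> exists n (v : 'I_n -> V) (w : 'I_n -> W),
  norm2 (u - \sum_i tens T (v i) (w i)) < e.
Proof.
move=> e0; have [_ [n [v [w ->]]] h] := dense_norm2 u (@tens_dense _ _ _ T) e0.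
by exists n, v, w.
Qed.

Lemma tensor_eq0 u : (forall v w, dotp T u (tens T v w) = 0) -> u = 0.
Proof.
move=> h; apply: (@nsq_eq0 _ _ (dotp T)); apply/eqP.
have := nsq_ge0 (dotp T) u; rewrite le_eqVlt => /predU1P [<- //|u0].
have [n [v [w hu]]] := tensor_approx u u0.
have ux : dotp T u (\sum_i tens T (v i) (w i)) = 0.
  by rewrite linear_sumr big1 // => i _; exact: h.
move: hu; rewrite nsqB ux.
by rewrite mulr0 subr0 gtrDl ltNge nsq_ge0.
Qed.

Lemma tensor_ext u u' :
  (forall v w, dotp T u (tens T v w) = dotp T u' (tens T v w)) -> u = u'.
Proof.
move=> h; apply/eqP; rewrite -subr_eq0; apply/eqP/tensor_eq0 => v w.
by rewrite linearBl /= h subrr.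
Qed.

Lemma slice_exists v u : exists z : W, forall w, dotp W z w = dotp T u (tens T v w).
Proof.
have [||||w|z _ hz] := @riesz_subspace R W setT (fun w => dotp T (tens T v w) u)
  (norm2 v * norm2 u) => //.
- by move=> a w w'; rewrite linearDr linearDl /= tensZr dotpZl.
- by apply: (le_trans (csq_form_le _ _ _)); rewrite norm2_tens mulrAC.
by exists z => w; rewrite dotpC -hz // -dotpC.
Qed.

(* [slice v] is the adjoint of [fun w => tens T v w]. *)
Definition slice v u : W := projT1 (cid (slice_exists v u)).

Lemma sliceE v u w : dotp W (slice v u) w = dotp T u (tens T v w).
Proof. by rewrite /slice; case: cid. Qed.

Lemma hilbert_ext (H : hilbert R) (x y : H) : (forall z, dotp H x z = dotp H y z) -> x = y.
Proof.
move=> h; apply/eqP; rewrite -subr_eq0 -(dnorm_eq0 (dotp H)).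
by rewrite linearBl /= h subrr.
Qed.

Lemma sliceP v a u u' : slice v (a *: u + u') = a *: slice v u + slice v u'.
Proof.
apply: hilbert_ext => w; rewrite sliceE linearDl [RHS]linearDl /= !dotpZl.
by rewrite !sliceE.
Qed.

Lemma slicePl a v v' u : slice (a *: v + v') u = Num.conj a *: slice v u + slice v' u.
Proof.
apply: hilbert_ext => w; rewrite sliceE linearDl /= tensZl.
by rewrite linearDr [RHS]linearDl /= dotpZl dotpZr !sliceE.
Qed.

Lemma slice_tens v v' w : slice v (tens T v' w) = dotp V v' v *: w.
Proof. by apply: hilbert_ext => w'; rewrite sliceE tens_dotp dotpZl. Qed.

Lemma norm2_slice v u : norm2 (slice v u) <= norm2 v * norm2 u.
Proof.
have := csq_form_le (dotp T) u (tens T v (slice v u)).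
rewrite norm2_tens -sliceE nsqE csqC.
have := nsq_ge0 (dotp W) (slice v u); rewrite le_eqVlt => /predU1P [<- _|n0].
  by rewrite mulr_ge0 // nsq_ge0.
by rewrite expr2 mulrA ler_pM2r // mulrC.
Qed.

(** The vector [z] is the image of [u] under the identity tensor [P]. It is obtained as the
    orthogonal projection of [u] onto the closed space [K] of vectors fixed by that operator, so
    that nothing has to be extended from elementary tensors by continuity. *)
Lemma tproj_exists (P : W -> W)
    (PP : forall w, P (P w) = P w) (Padj : forall w w', dotp W (P w) w' = dotp W w (P w')) u :
  exists z : T, (forall v w, dotp T z (tens T v w) = dotp T u (tens T v (P w))) /\
    forall x, (forall v w, dotp T x (tens T v (P w)) = dotp T x (tens T v w)) ->
      dotp T x u = dotp T x z.
Proof.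
pose K := [set x | forall v w, dotp T x (tens T v (P w)) = dotp T x (tens T v w)].
have KE x : K x <-> forall v w, dotp T x (tens T v w - tens T v (P w)) = 0.
  split=> h v w; first by rewrite linearBr /= h subrr.
  by apply/esym/eqP; rewrite -subr_eq0 -(h v w) linearBr.
have [||x h|||z Kz hz] := @riesz_subspace R T K (fun x => dotp T x u) (norm2 u).
- by move=> v w; rewrite !linear0l.
- by move=> a x y hx hy v w; rewrite !linearDl /= !dotpZl hx hy.
- apply/KE => v w; apply: dotp_closed => e /h [x' Kx' xx'].
  by exists x' => //; exact: (proj1 (KE x')).
- by move=> a x y; rewrite linearDl /= dotpZl.
- by move=> x; rewrite mulrC csq_form_le.
exists z; split=> // v w.
have KP : K (tens T v (P w)).
  by move=> v' w'; rewrite !tens_dotp Padj PP -Padj.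
by rewrite -Kz dotpC -hz // -dotpC.
Qed.

End Tensor.

(** The trace on clopen sets of the projection-valued measure of a covariant representation. Locally
    constant cocycles never cut along other sets. *)
Record clopen_action (R : realType) (G : groupType) (X : topologicalType)
    (S : dynamical_system G X) (L : hilbert R) (s : unitary_rep G L) := ClopenAction {
  cproj :> set X -> L -> L;
  cprojP : forall A a u v, cproj A (a *: u + v) = a *: cproj A u + cproj A v;
  cprojT : forall u, cproj setT u = u;
  cprojI : forall A B u, clopen A -> clopen B ->
    cproj (A `&` B) u = cproj A (cproj B u);
  cprojU : forall A B u, clopen A -> clopen B -> A `&` B = set0 ->
    cproj (A `|` B) u = cproj A u + cproj B u;
  cproj_adj : forall A u v, clopen A -> dotp L (cproj A u) v = dotp L u (cproj A v);
  cproj_act : forall A g u, clopen A ->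
    s g (cproj A u) = cproj (S g^-1%g @^-1` A) (s g u) }.

Section ClopenIndicator.
Variables (R : realType) (X : topologicalType).

Definition ind (A : set X) (x : X) : R[i]^o := `[< A x >]%:R.

Lemma ind_continuous A : clopen A -> continuous (ind A).
Proof.
move=> [oA cA] x; have [Ax|Ax] := pselect (A x).
  apply: cvg_near_cst; near=> y; rewrite /ind; congr (_%:R : R[i]); congr nat_of_bool.
  apply/asboolP/asboolP => // _; near: y; exact: open_nbhs_nbhs.
apply: cvg_near_cst; near=> y; rewrite /ind; congr (_%:R : R[i]); congr nat_of_bool.
apply/asboolP/asboolP => // Ay; suff : (~` A) y by [].
by near: y; apply: open_nbhs_nbhs; split=> //; exact: closed_openC.
Unshelve. all: by end_near. Qed.

Definition ind_cts (A : set X) : cfuns R X :=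
  if pselect (clopen A) is left h then mkcts (ind_continuous h) else cfun1 R X.

Lemma ind_ctsE A x : clopen A -> ind_cts A x = ind A x.
Proof. by rewrite /ind_cts; case: pselect. Qed.

End ClopenIndicator.

Section CovariantClopen.
Variables (R : realType) (G : groupType) (X : topologicalType).
Variables (S : dynamical_system G X) (W : hilbert R) (P : covariant_rep S W).

Let Q (A : set X) (w : W) := cov_X P (ind_cts R A) w.

Lemma covariant_clopen : clopen_action S (cov_G P).
Proof.
have cf (f f' : cfuns R X) : (forall x, f x = f' x) -> f = f'.
  by move=> h; apply/continuousEP.
exists Q.
- by move=> A a u v; rewrite /Q linearP.
- move=> u; rewrite -[RHS](crep1 (cov_X P)) /Q; congr (cov_X P _ _).
  apply: cf => x; rewrite ind_ctsE; last exact: clopenT.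
  by rewrite /ind asboolT.
- move=> A B u cA cB; rewrite /Q -crepM; congr (cov_X P _ _); apply: cf => x.
  rewrite ind_ctsE; last exact: clopenI.
  rewrite /= /cfunM /mkcts !ind_ctsE // /ind -natrM mulnb; congr (_%:R : R[i]).
  by rewrite -asbool_and.
- move=> A B u cA cB AB; rewrite /Q -crepD; congr (cov_X P _ _); apply: cf => x.
  rewrite ind_ctsE; last exact: clopenU.
  rewrite /= /cfunD /mkcts !ind_ctsE // /ind -natrD; congr (_%:R : R[i]).
  have := congr1 (@^~ x) AB; rewrite /= => ABx.
  have [Ax|Ax] := pselect (A x); have [Bx|Bx] := pselect (B x).
  + by exfalso; rewrite -[False]/(set0 x) -AB.
  + by rewrite !(asboolT Ax) (asboolF Bx) asboolT //; left.
  + by rewrite (asboolF Ax) (asboolT Bx) asboolT //; right.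
  + by rewrite (asboolF Ax) (asboolF Bx) asboolF // => -[].
- move=> A u v cA; rewrite /Q crep_adj; congr (dotp W u (cov_X P _ v)).
  apply: cf => x; rewrite -[LHS]/(Num.conj (ind_cts R A x : R[i])) !ind_ctsE // /ind.
  by case: `[< _ >]; rewrite ?conjC1 ?conjC0.
- move=> A g u cA; have := covP P g (ind_cts R A) (cov_G P g u).
  rewrite -urepM mulVg urep1 /Q => ->; congr (cov_X P _ _); apply: cf => x.
  rewrite [RHS]ind_ctsE; last by apply: preimage_clopen => //; exact: cts_fun.
  by rewrite /= ind_ctsE.
Qed.

End CovariantClopen.

Section TensorClopen.
Variables (R : realType) (G : groupType) (X : topologicalType).
Variables (S : dynamical_system G X) (V W : hilbert R).
Variables (s : unitary_rep G V) (r : unitary_rep G W) (P : clopen_action S r).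
Variable T : tensor_rep s r.

Let tsp : hilbert_tensor V W := trep_space T.

Lemma trepV (g : G) (u : tsp) v w :
  dotp tsp (T g u) (tens tsp v w) = dotp tsp u (tens tsp (s g^-1%g v) (r g^-1%g w)).
Proof.
rewrite -[RHS](urep_dotp T g) /= trepE -!urepM mulgV !urep1 //.
Qed.

Lemma tensor_clopen : exists Q : clopen_action S T,
  forall A v u, clopen A -> slice v (Q A u) = P A (slice v u).
Proof.
(* [tproj_exists] wants a self-adjoint idempotent for every [A]; the identity serves off the clopen
   sets. *)
pose P' A := if pselect (clopen A) is left _ then P A else id.
have P'P A w : P' A (P' A w) = P' A w.
  by rewrite /P'; case: pselect => // cA; rewrite -cprojI // setIid.
have P'adj A w w' : dotp W (P' A w) w' = dotp W w (P' A w').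
  by rewrite /P'; case: pselect => // cA; rewrite cproj_adj.
have ex A := @tproj_exists R V W tsp (P' A) (P'P A) (P'adj A).
pose Q A u := projT1 (cid (ex A u)).
have hQ A u := projT2 (cid (ex A u)).
have QE0 A u v w : dotp tsp (Q A u) (tens tsp v w) = dotp tsp u (tens tsp v (P' A w)).
  exact: (hQ A u).1.
have QK A u x : (forall v w, dotp tsp x (tens tsp v (P' A w)) = dotp tsp x (tens tsp v w)) ->
    dotp tsp x u = dotp tsp x (Q A u).
  exact: (hQ A u).2.
have QQ A u v : dotp tsp (Q A u) v = dotp tsp (Q A u) (Q A v).
  by apply: QK => x w; rewrite !QE0 P'P.
have QE A u v w : clopen A ->
    dotp tsp (Q A u) (tens tsp v w) = dotp tsp u (tens tsp v (P A w)).
  by move=> cA; rewrite QE0 /P'; case: pselect.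
have slQ A v u : clopen A -> slice v (Q A u) = P A (slice v u).
  move=> cA; apply: hilbert_ext => w; rewrite sliceE QE // -sliceE.
  by rewrite cproj_adj.
have QL A a u v : Q A (a *: u + v) = a *: Q A u + Q A v.
  apply: tensor_ext => x w.
  by rewrite QE0 linearDl [RHS]linearDl /= !dotpZl !QE0.
have QT u : Q setT u = u.
  by apply: tensor_ext => v w; rewrite QE ?cprojT //; exact: clopenT.
have QI A B u : clopen A -> clopen B -> Q (A `&` B) u = Q A (Q B u).
  move=> cA cB; apply: tensor_ext => v w.
  rewrite (QE _ _ _ _ (clopenI cA cB)) (QE _ _ _ _ cA) (QE _ _ _ _ cB).
  by rewrite -(cprojI _ _ cB cA) setIC.
have QU A B u : clopen A -> clopen B -> A `&` B = set0 ->
    Q (A `|` B) u = Q A u + Q B u.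
  move=> cA cB AB; apply: tensor_ext => v w; rewrite QE; last exact: clopenU.
  by rewrite linearDl /= !QE // cprojU // linearDr linearDr.
have Qadj A u v : clopen A -> dotp tsp (Q A u) v = dotp tsp u (Q A v).
  by move=> cA; rewrite QQ dotpC -QQ -dotpC.
have Qact A g u : clopen A -> T g (Q A u) = Q (S g^-1%g @^-1` A) (T g u).
  move=> cA; have cA' : clopen (S g^-1%g @^-1` A).
    by apply: preimage_clopen => //; exact: cts_fun.
  apply: tensor_ext => v w; rewrite trepV !QE // trepV; congr (dotp _ _ (tens _ _ _)).
  rewrite -[in RHS](urep1 r w) -(mulgV g) urepM -cproj_act //.
  by rewrite -urepM mulVg urep1.
by exists (ClopenAction QL QT QI QU Qadj Qact).
Qed.

End TensorClopen.

(** * Locally constant maps and germs *)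

(** Compactness enters in its near-covering form, along the filter of lists ordered by inclusion. *)
Lemma compact_seq_cover (X : topologicalType) (C : X -> set X) :
  compact [set: X] -> (forall x, nbhs x (C x)) ->
  exists l : seq X, forall y, exists2 x, x \in l & C x y.
Proof.
move=> /compact_near_coveringP cX hC.
pose F := filter_from [set: seq X] (fun l0 => [set l : seq X | {subset l0 <= l}]).
have FF : Filter F.
  apply: filter_from_filter; first by exists [::].
  move=> l1 l2 _ _; exists (l1 ++ l2) => // l /= h.
  by split=> x xl; apply: h; rewrite mem_cat xl ?orbT.
have [|l0 _ h] := cX _ F (fun l y => exists2 x, x \in l & C x y) FF.
  move=> x _; exists (C x, [set l : seq X | x \in l]) => /=.
    split; first exact: hC.
    by exists [:: x] => // l /= h; apply: h; rewrite mem_head.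
  by move=> [y l] /= [Cxy xl]; exists x.
by exists l0 => y; apply: (h l0).
Qed.

Section LocallyConstant.
Variable X : topologicalType.

Definition lc (D : Type) (f : X -> D) := forall x, \forall y \near x, f y = f x.

Lemma lc_clopen (D : Type) (f : X -> D) (A : set D) : lc f -> clopen (f @^-1` A).
Proof.
move=> lf; have op (B : set D) : open (f @^-1` B).
  rewrite openE => x /= Bx; rewrite /interior /=.
  by apply: filterS (lf x) => y /= ->.
by split=> //; rewrite -openC preimage_setC.
Qed.

Lemma lc_comp (D D' : Type) (g : D -> D') (f : X -> D) : lc f -> lc (fun x => g (f x)).
Proof. by move=> lf x; apply: filterS (lf x) => y ->. Qed.

Lemma lc_pair (D D' : Type) (f : X -> D) (g : X -> D') :
  lc f -> lc g -> lc (fun x => (f x, g x)).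
Proof. by move=> lf lg x; apply: filterS2 (lf x) (lg x) => y -> ->. Qed.

Lemma lc_cst (D : Type) (d : D) : lc (fun=> d).
Proof. by move=> x; exact: nearW. Qed.

Lemma lc_finite (D : eqType) (f : X -> D) : compact [set: X] -> lc f ->
  exists s : seq D, uniq s /\ forall x, f x \in s.
Proof.
move=> cX lf.
have [l hl] := compact_seq_cover cX lf.
exists (undup [seq f x | x <- l]); split; first exact: undup_uniq.
by move=> x; have [y yl ->] := hl x; rewrite mem_undup map_f.
Qed.

End LocallyConstant.

Lemma lc_precomp (X Y : topologicalType) (D : Type) (g : X -> Y) (f : Y -> D) :
  continuous g -> lc f -> lc (fun x => f (g x)).
Proof. by move=> cg lf x; exact: (cg x _ (lf (g x))). Qed.

Section Germs.
Variables (R : realType) (G : groupType) (X : topologicalType).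
Variables (S : dynamical_system G X) (L : hilbert R) (s : unitary_rep G L).
Variables (Q : clopen_action S s).
Hypothesis cX : compact [set: X].
Implicit Types (u v w : L) (A B C : set X) (x : X).

Lemma cproj0r A : Q A 0 = 0.
Proof.
by have := cprojP Q A (- 1) 0 0; rewrite scaler0 addr0 scaleN1r addNr.
Qed.

Lemma cproj_set0 u : Q set0 u = 0.
Proof.
have c0 : clopen (set0 : set X) by split; [exact: open0 | exact: closed0].
have := cprojU Q u c0 c0 (setI0 _); rewrite setU0 => /eqP.
by rewrite -subr_eq subrr eq_sym => /eqP.
Qed.

Lemma cproj_disj A B u : clopen A -> clopen B -> A `&` B = set0 -> Q A (Q B u) = 0.
Proof. by move=> cA cB AB; rewrite -cprojI // AB cproj_set0. Qed.

(* [L] is treated as the global sections of a sheaf on [X] with restrictions [Q A]. *)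
Definition germ x u v := exists A, [/\ clopen A, A x & Q A u = Q A v].

Lemma cproj_sub A B u v : clopen A -> clopen B -> B `<=` A -> Q A u = Q A v ->
  Q B u = Q B v.
Proof.
move=> cA cB BA Auv; have -> : B = B `&` A by apply/esym/setIidl.
by rewrite !cprojI // Auv.
Qed.

Lemma germ_refl x u : germ x u u.
Proof. by exists setT; split=> //; exact: clopenT. Qed.

Lemma germ_sym x u v : germ x u v -> germ x v u.
Proof. by move=> [A [cA Ax h]]; exists A. Qed.

Lemma germ_trans v x u w : germ x u v -> germ x v w -> germ x u w.
Proof.
move=> [A [cA Ax hA]] [B [cB Bx hB]]; exists (A `&` B); split=> //.
  exact: clopenI.
have cAB := clopenI cA cB.
transitivity (Q (A `&` B) v).
  by apply: (cproj_sub cA cAB) hA => // y [].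
by apply: (cproj_sub cB cAB) hB => // y [].
Qed.

Lemma germP x a u u' v v' : germ x u u' -> germ x v v' -> germ x (a *: u + v) (a *: u' + v').
Proof.
move=> [A [cA Ax hA]] [B [cB Bx hB]]; exists (A `&` B); split=> //.
  exact: clopenI.
have cAB := clopenI cA cB.
rewrite !cprojP; congr (_ *: _ + _).
  by apply: (cproj_sub cA cAB) hA => // y [].
by apply: (cproj_sub cB cAB) hB => // y [].
Qed.

Lemma germD x u u' v v' : germ x u u' -> germ x v v' -> germ x (u + v) (u' + v').
Proof. by move=> h; rewrite -[u]scale1r -[u']scale1r; exact: germP. Qed.

Lemma germB x u u' v v' : germ x u u' -> germ x v v' -> germ x (u - v) (u' - v').
Proof.
have E a b : a - b = (- 1) *: b + a :> L by rewrite scaleN1r addrC.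
by move=> h h'; rewrite !E; exact: germP.
Qed.

Lemma germ_act g x u v : germ x u v -> germ (S g x) (s g u) (s g v).
Proof.
move=> [A [cA Ax hA]]; exists (S g^-1%g @^-1` A); split.
- by apply: preimage_clopen => //; exact: cts_fun.
- by rewrite /= -actM mulVg act1.
by rewrite -!cproj_act // hA.
Qed.

Lemma germ_proj_in A x u : clopen A -> A x -> germ x (Q A u) u.
Proof. by move=> cA Ax; exists A; split=> //; rewrite -cprojI // setIid. Qed.

Lemma germ_proj_out A x u : clopen A -> ~ A x -> germ x (Q A u) 0.
Proof.
move=> cA Ax; have cA' : clopen (~` A) by exact: clopenC.
by exists (~` A); split=> //; rewrite cproj0r cproj_disj // setICl.
Qed.

(* Compactness turns equality of germs into equality. *)
Lemma germ_cproj B u v : clopen B -> (forall x, B x -> germ x u v) -> Q B u = Q B v.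
Proof.
move=> cB h.
have /choice [C hC] : forall x, exists C, [/\ clopen C, C x & Q (B `&` C) u = Q (B `&` C) v].
  move=> x; have [/h [A [cA Ax hA]]|Bx] := pselect (B x).
    exists A; split=> //; apply: (cproj_sub cA _ _ hA); first exact: clopenI.
    by move=> y [].
  exists (~` B); split=> //; first exact: clopenC.
  by rewrite setICr !cproj_set0.
have [|D cov] := @compact_seq_cover X C cX.
  by move=> x; have [[oC _] Cx _] := hC x; exact: open_nbhs_nbhs.
have main (l : seq X) : clopen (\big[setU/set0]_(x <- l) C x) /\
    Q (B `&` \big[setU/set0]_(x <- l) C x) u = Q (B `&` \big[setU/set0]_(x <- l) C x) v.
  elim: l => [|x l [cl ih]].
    rewrite !big_nil setI0 !cproj_set0; split=> //.
    by split; [exact: open0 | exact: closed0].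
  rewrite !big_cons; move: cl ih; set U := \big[setU/set0]_(y <- l) C y => cl ih.
  have [cC Cx hx] := hC x; split; first exact: clopenU.
  (* [cprojU] is additive on disjoint unions only, so the cover is made disjoint. *)
  have -> : B `&` (C x `|` U) = (B `&` C x) `|` (B `&` (U `&` ~` C x)).
    by rewrite predeqE => y; have [?|?] := pselect (C x y); split=> /=; tauto.
  have c1 : clopen (B `&` C x) by exact: clopenI.
  have c2 : clopen (U `&` ~` C x) by apply: clopenI => //; exact: clopenC.
  have c3 : clopen (B `&` (U `&` ~` C x)) by exact: clopenI.
  have c4 : clopen (B `&` U) by exact: clopenI.
  have dj : (B `&` C x) `&` (B `&` (U `&` ~` C x)) = set0.
    by apply/seteqP; split=> // y [[_ Cy] [_ []]].
  rewrite !cprojU //.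
  by congr (_ + _) => //; apply: (cproj_sub c4 c3 _ ih) => y [? []].
have [_] := main D.
suff -> : \big[setU/set0]_(x <- D) C x = setT by rewrite setIT.
apply/seteqP; split=> // y _; have [x xD Cxy] := cov y.
by rewrite -bigcup_seq; exists x.
Qed.

Lemma germ_ext u v : (forall x, germ x u v) -> u = v.
Proof.
by move=> h; rewrite -(cprojT Q u) -(cprojT Q v); apply: germ_cproj => //; exact: clopenT.
Qed.

Section Partition.
Variables (D : eqType) (f : X -> D) (r : seq D).
Hypotheses (lf : lc f) (ur : uniq r) (fr : forall x, f x \in r).

Lemma germ_sum x (F : D -> L) :
  germ x (\sum_(d <- r) Q (f @^-1` [set d]) (F d)) (F (f x)).
Proof.
rewrite (bigD1_seq (f x)) //= -[X in germ _ _ X]addr0; apply: germD.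
  by apply: germ_proj_in => //; exact: lc_clopen.
elim/big_rec: _ => [|d y dx ih]; first exact: germ_refl.
rewrite -[0]addr0; apply: germD ih; apply: germ_proj_out; first exact: lc_clopen.
by move=> /= fd; rewrite fd eqxx in dx.
Qed.

Lemma cproj_partition u : u = \sum_(d <- r) Q (f @^-1` [set d]) u.
Proof. by apply: germ_ext => x; exact/germ_sym/(germ_sum x (fun=> u)). Qed.

Lemma norm2_cproj A u : clopen A -> norm2 (Q A u) = complex.Re (dotp L (Q A u) u).
Proof. by move=> cA; rewrite /nsq -cproj_adj // -cprojI // setIid. Qed.

Lemma norm2_cproj_le A u : clopen A -> norm2 (Q A u) <= norm2 u.
Proof.
move=> cA; have := nsq_ge0 (dotp L) (u - Q A u).
by rewrite nsqB dotpC ReJ -norm2_cproj //; lra.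
Qed.

Lemma norm2_partition u : norm2 u = \sum_(d <- r) norm2 (Q (f @^-1` [set d]) u).
Proof.
rewrite {1}/nsq {1}(cproj_partition u) linear_sumlz Re_sum; apply: eq_bigr => d _.
by rewrite norm2_cproj //; exact: lc_clopen.
Qed.

Lemma dotp_partition u v :
  dotp L u v = \sum_(d <- r) dotp L (Q (f @^-1` [set d]) u) v.
Proof. by rewrite {1}(cproj_partition u) linear_sumlz. Qed.

(** The constant depends on the partition and not on [F]; this makes pulling back continuous in the
    cochain. *)
Lemma norm2_glue_le (F : D -> L) u : (forall x, germ x u (F (f x))) ->
  norm2 u <= 2 ^+ size r * \sum_(d <- r) norm2 (F d).
Proof.
move=> h; have -> : u = \sum_(d <- r) Q (f @^-1` [set d]) (F d).
  by apply: germ_ext => x; apply: germ_trans (h x) _; exact/germ_sym/germ_sum.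
apply: (le_trans (nsq_sum_le _ _ _)); rewrite ler_wpM2l ?exprn_ge0 //.
apply: ler_sum => d _; apply: norm2_cproj_le; exact: lc_clopen.
Qed.

End Partition.

(** The gluing axiom of the sheaf: [F], finitely valued by compactness, serves as its own
    partition. *)
Lemma glue_exists (F : X -> L) : lc F -> exists u, forall x, germ x u (F x).
Proof.
move=> lF; have [r [ur Fr]] := lc_finite cX lF.
by exists (\sum_(d <- r) Q (F @^-1` [set d]) d) => x; exact: (germ_sum lF ur Fr x id).
Qed.

End Germs.

(** * The representation of [H] *)

Record coupling (G H : groupType) (X Y : topologicalType)
    (S : dynamical_system G X) (T : dynamical_system H Y) := Coupling {
  cp : X -> Y;
  cq : Y -> X;
  ca : G -> X -> H;
  cb : H -> Y -> G;
  cg : X -> G;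
  ch : Y -> H;
  cp_continuous : continuous cp;
  cq_continuous : continuous cq;
  ca_lc : forall k, lc (ca k);
  cb_lc : forall t, lc (cb t);
  cg_lc : lc cg;
  ch_lc : lc ch;
  cpE : forall k x, cp (S k x) = T (ca k x) (cp x);
  cqE : forall t y, cq (T t y) = S (cb t y) (cq y);
  cqpE : forall x, cq (cp x) = S (cg x) x;
  cpqE : forall y, cp (cq y) = T (ch y) y;
  c_free : topologically_free S;
  cX_compact : compact [set: X];
  cY_compact : compact [set: Y] }.

Lemma actK (G : groupType) (X : topologicalType) (S : dynamical_system G X) (k : G) x :
  S k^-1%g (S k x) = x.
Proof. by rewrite -actM mulVg act1. Qed.

Lemma actVK (G : groupType) (X : topologicalType) (S : dynamical_system G X) (k : G) x :
  S k (S k^-1%g x) = x.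
Proof. by rewrite -actM mulgV act1. Qed.

Lemma urepK (R : realType) (G : groupType) (V : hilbert R) (s : unitary_rep G V) (k : G) v :
  s k^-1%g (s k v) = v.
Proof. by rewrite -urepM mulVg urep1. Qed.

Lemma urepVK (R : realType) (G : groupType) (V : hilbert R) (s : unitary_rep G V) (k : G) v :
  s k (s k^-1%g v) = v.
Proof. by rewrite -urepM mulgV urep1. Qed.

Lemma norm2_urep (R : realType) (G : groupType) (V : hilbert R) (s : unitary_rep G V) k v :
  norm2 (s k v) = norm2 v.
Proof. by rewrite /nsq urep_dotp. Qed.

Section Coupling.
Variables (G H : groupType) (X Y : topologicalType).
Variables (S : dynamical_system G X) (T : dynamical_system H Y) (c : coupling S T).
Implicit Types (x : X) (y : Y) (t : H) (k : G).

Local Notation p := (cp c).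
Local Notation q := (cq c).
Local Notation a := (ca c).
Local Notation b := (cb c).
Local Notation g := (cg c).
Local Notation h := (ch c).

(** Otherwise [k2^-1 * k1] would be a nontrivial element fixing an open set pointwise. *)
Lemma free_near k1 k2 x : (\forall x' \near x, S k1 x' = S k2 x') -> k1 = k2.
Proof.
move=> hn; apply: contrapT => ne.
have ne' : (k2^-1 * k1)%g <> 1%g.
  by move=> /(congr1 (fun k => (k2 * k)%g)); rewrite mulgA mulgV mul1g mulg1.
have [x' [hx' fx]] := c_free c ne' (ex_intro _ x hn) (@open_interior _ _).
by apply: fx; rewrite actM (interior_subset hx') actK.
Qed.

Lemma lc_free (k1 k2 : X -> G) : lc k1 -> lc k2 ->
  (forall x, S (k1 x) x = S (k2 x) x) -> forall x, k1 x = k2 x.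
Proof.
move=> l1 l2 e x; apply: (@free_near _ _ x).
by apply: filterS2 (l1 x) (l2 x) => x' <- <-.
Qed.

Lemma lc_app (Z Z' : topologicalType) (A D : Type) (f : A -> Z' -> D) (u : Z -> A) (v : Z -> Z') :
  (forall i, lc (f i)) -> lc u -> continuous v -> lc (fun z => f (u z) (v z)).
Proof.
move=> lf lu cv z; have := cv z _ (lf (u z) (v z)).
by apply: filterS2 (lu z) => z' ->.
Qed.

Lemma act_continuous k : continuous (S k).
Proof. exact: cts_fun. Qed.

(* Both sides move [x] to [q (p (S k x))]; freeness removes the isotropy. *)
Lemma cocycle_ab k x : (b (a k x) (p x) * g x = g (S k x) * k)%g.
Proof.
apply: (@lc_free (fun x => (b (a k x) (p x) * g x)%g) (fun x => (g (S k x) * k)%g)).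
- have l1 := lc_app (cb_lc c) (ca_lc c k) (@cp_continuous _ _ _ _ _ _ c).
  exact: (lc_comp (fun d => (d.1 * d.2)%g) (lc_pair l1 (cg_lc c))).
- apply: (lc_comp (fun d => (d * k)%g)); apply: lc_precomp (cg_lc c).
  exact: act_continuous.
- by move=> {}x; rewrite !actM -!cqpE -cqE -cpE.
Qed.

(* On the clopen set where [h = t] the map [q] is injective; its image is [cZ t] and
   its inverse is [cr t]. *)
Definition cr t x : Y := T t^-1%g (p x).

Definition cZ t := [set x | q (cr t x) = x /\ h (cr t x) = t].

Lemma cr_continuous t : continuous (cr t).
Proof.
move=> x; apply: continuous_comp; first exact: cp_continuous.
exact: cts_fun.
Qed.

Lemma cr_q y : cr (h y) (q y) = y.
Proof. by rewrite /cr cpqE actK. Qed.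

Lemma cZ_q y : cZ (h y) (q y).
Proof. by rewrite /cZ /= cr_q. Qed.

(** Openness: for [x'] near a point [x] of [cZ t], the points [x'] and [q (cr t x')] have the same
    image under [p] and the same value of [g]. So [q \o p] acts on both as the injective map
    [S (g x)], and they coincide. Closedness rests on the Hausdorff property. *)
Lemma cZ_clopen t : clopen (cZ t).
Proof.
have lh : lc (fun x => h (cr t x)) by apply: lc_precomp (ch_lc c); exact: cr_continuous.
have cqr : continuous (fun x => q (cr t x)).
  by move=> x; apply: continuous_comp; [exact: cr_continuous | exact: cq_continuous].
split.
  rewrite openE => x [qx hx]; rewrite /interior /=.
  have lgq : \forall x' \near x, g (q (cr t x')) = g (q (cr t x)).
    exact: (lc_precomp cqr (cg_lc c)).
  rewrite qx in lgq.
  near=> x'.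
  have hx' : h (cr t x') = t by rewrite -[RHS]hx; near: x'; exact: lh.
  split=> //.
  have pE : p (q (cr t x')) = p x' by rewrite cpqE hx' /cr actVK.
  have gx' : g x' = g x by near: x'; exact: cg_lc.
  have gq : g (q (cr t x')) = g x by near: x'.
  have e : S (g x) (q (cr t x')) = S (g x) x' by rewrite -{1}gq -cqpE pE cqpE gx'.
  by rewrite -(actK S (g x) (q _)) e actK.
rewrite -openC openE => x /= nZ; rewrite /interior /=.
have [hx|hx] := pselect (h (cr t x) = t); last first.
  apply: filterS (lh x) => x' hx' [_ e]; apply: hx; by rewrite -hx'.
have nx : q (cr t x) != x by apply/eqP => e; apply: nZ.
have := act_hausdorff S; rewrite open_hausdorff => /(_ _ _ nx) [[A B] /= [Ax Bx] [oA oB AB]].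
have nA : \forall x' \near x, A (q (cr t x')).
  by apply: cqr; apply: open_nbhs_nbhs; split=> //; exact: set_mem.
have nB : \forall x' \near x, B x' by apply: open_nbhs_nbhs; split=> //; exact: set_mem.
apply: filterS2 nA nB => x' A1 B1 [e _]; rewrite e in A1.
by have : (A `&` B) x' by []; rewrite (eqP AB).
Unshelve. all: by end_near. Qed.

(** Freeness speaks of open sets of [X], so the functions on [Y] are carried to a neighbourhood of
    [q y] by the local inverse [cr (h y)]. *)
Lemma lc_free_q (k1 k2 : Y -> G) : lc k1 -> lc k2 ->
  (forall y, S (k1 y) (q y) = S (k2 y) (q y)) -> forall y, k1 y = k2 y.
Proof.
move=> l1 l2 e y; apply: (@free_near _ _ (q y)).
have nr (D : Type) (f : Y -> D) : lc f -> \forall x \near q y, f (cr (h y) x) = f y.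
  move=> lf; have := lc_precomp (@cr_continuous (h y)) lf (q y).
  by rewrite cr_q.
have nZ : \forall x \near q y, cZ (h y) x.
  by apply: open_nbhs_nbhs; split; [case: (cZ_clopen (h y)) | exact: cZ_q].
apply: filterS3 nZ (nr _ _ l1) (nr _ _ l2) => x [qx _] e1 e2.
by have := e (cr (h y) x); rewrite qx e1 e2.
Qed.

(** Both sides move [q y] to [q (T (t * t') y)]; freeness identifies them. *)
Lemma cbM t t' y : b (t * t')%g y = (b t (T t' y) * b t' y)%g.
Proof.
apply: (lc_free_q (k1 := b (t * t')%g) (k2 := fun y => (b t (T t' y) * b t' y)%g)).
- exact: cb_lc.
- have l1 : lc (fun y => b t (T t' y)) by apply: lc_precomp (cb_lc c t); exact: cts_fun.
  exact: (lc_comp (fun d => (d.1 * d.2)%g) (lc_pair l1 (cb_lc c t'))).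
- by move=> {}y; rewrite actM -!cqE actM.
Qed.

Lemma cb1 y : b 1%g y = 1%g.
Proof.
apply: (lc_free_q (k1 := b 1%g) (k2 := fun=> 1%g)); first exact: cb_lc.
  exact: lc_cst.
by move=> {}y; rewrite -cqE !act1.
Qed.

Section Rep.
Variables (R : realType) (L : hilbert R) (s : unitary_rep G L) (Q : clopen_action S s).
Implicit Types (u v : L).

Let cX : compact [set: X] := cX_compact c.
Let cY : compact [set: Y] := cY_compact c.
Local Notation germ := (germ Q).

Definition ch_values : seq H := projT1 (cid (lc_finite cY (ch_lc c))).

Lemma mem_ch_values y : h y \in ch_values.
Proof. by rewrite /ch_values; case: cid => l []. Qed.

(* [rspace] is the space of sections over [Y] of the pullback along [q] of the sheaf of
   [L]; its component at [t] carries the part over [h = t]. *)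
Let fZ t := [set u | Q (cZ t) u = u].

Let fZ0 t : fZ t 0.
Proof. exact: cproj0r. Qed.

Let fZP t (z : R[i]) u v : fZ t u -> fZ t v -> fZ t (z *: u + v).
Proof. by move=> hu hv; rewrite /fZ /= cprojP hu hv. Qed.

Let fZ_closed t u :
  (forall e : R, 0 < e -> exists2 v, fZ t v & norm2 (u - v) < e) -> fZ t u.
Proof.
move=> hu; apply/eqP; rewrite -subr_eq0; apply/eqP/(@nsq_eq0 _ _ (dotp L)).
apply/eqP; rewrite eq_le nsq_ge0 andbT; apply/ler_addgt0Pl => e e0; rewrite addr0.
have [v hv uv] := hu (e / 4) (divr_gt0 e0 (ltr0n _ 4)).
have -> : Q (cZ t) u - u = Q (cZ t) (u - v) - (u - v).
  have -> : Q (cZ t) (u - v) = Q (cZ t) u - v.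
    by rewrite -[in RHS]hv -[_ - v]addrC -scaleN1r cprojP scaleN1r addrC.
  by rewrite opprB addrA subrK.
apply: (le_trans (nsqD_le _ _ _)); rewrite nsqN.
have := norm2_cproj_le Q (u - v) (cZ_clopen t).
lra.
Qed.

Let fZ_out t u : t \notin ch_values -> fZ t u -> u = 0.
Proof.
move=> ht; rewrite /fZ /= => <-.
suff -> : cZ t = set0 by rewrite cproj_set0.
apply/seteqP; split=> // x [_ hx]; move: ht.
by rewrite -hx mem_ch_values.
Qed.

Definition rfam : subspace_family L H := SubspaceFamily fZ0 fZP fZ_closed fZ_out.

Definition rspace := dsum_hilbert rfam.
Implicit Types (xi zeta : rspace).

Lemma rspaceZ xi t : Q (cZ t) (dsum_val xi t) = dsum_val xi t.
Proof. exact: (dsumP xi t). Qed.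

(* [ev xi y] represents the value of the section [xi] over [y], a germ at [q y]. *)
Definition ev xi y : L := dsum_val xi (h y).

Lemma evP (z : R[i]) xi zeta y : ev (z *: xi + zeta) y = z *: ev xi y + ev zeta y.
Proof. by []. Qed.

Lemma evB xi zeta y : ev (xi - zeta) y = ev xi y - ev zeta y.
Proof. by []. Qed.

Lemma rspace_ext xi zeta : (forall y, germ (q y) (ev xi y) (ev zeta y)) -> xi = zeta.
Proof.
move=> e; apply: dsum_ext => t; apply: (germ_ext (Q := Q) cX) => x.
have [[qx hx]|Zx] := pselect (cZ t x).
  by have := e (cr t x); rewrite /ev qx hx.
rewrite -(rspaceZ xi) -(rspaceZ zeta).
apply: (germ_trans (germ_proj_out Q _ (cZ_clopen t) Zx)); apply: germ_sym.
exact: (germ_proj_out Q _ (cZ_clopen t) Zx).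
Qed.

(** On each component, [F] is transported to [X] by [cr t], glued there and cut down to [cZ t]. *)
Lemma rspace_exists (F : Y -> L) : lc F -> exists xi, forall y, germ (q y) (ev xi y) (F y).
Proof.
move=> lF.
have /choice [u hu] : forall t, exists u, forall x, germ x u (F (cr t x)).
  move=> t; apply: (glue_exists Q cX (F := fun x => F (cr t x))).
  by apply: lc_precomp lF; exact: cr_continuous.
have Zu t : rfam t (Q (cZ t) (u t)).
  by rewrite /rfam /fZ /= -cprojI ?setIid //; exact: cZ_clopen.
exists (mk_dsum Zu) => y; rewrite /ev /=.
apply: (germ_trans (germ_proj_in Q _ (cZ_clopen _) (cZ_q y))).
by have := hu (h y) (q y); rewrite cr_q.
Qed.

Definition rmk (F : Y -> L) : rspace :=
  if pselect (lc F) is left lF then projT1 (cid (rspace_exists lF)) else 0.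

Lemma rmkE (F : Y -> L) y : lc F -> germ (q y) (ev (rmk F) y) (F y).
Proof. by rewrite /rmk; case: pselect => // lF _; case: cid. Qed.

(** The value over [T t^-1 y] is carried to the stalk over [y] by the element of [G] that moves
    [q (T t^-1 y)] to [q y]. *)
Definition ract t xi : rspace :=
  rmk (fun y => s (b t (T t^-1%g y)) (ev xi (T t^-1%g y))).

Lemma ractE t xi y :
  germ (q (T t y)) (ev (ract t xi) (T t y)) (s (b t y) (ev xi y)).
Proof.
rewrite -[in X in germ _ _ X](actK T t y); apply: rmkE.
have cT : continuous (T t^-1%g) by exact: cts_fun.
have lev : lc (ev xi) by exact: (lc_comp (dsum_val xi) (ch_lc c)).
have l := lc_pair (lc_precomp cT (cb_lc c t)) (lc_precomp cT lev).
exact: (lc_comp (fun d => s d.1 d.2) l).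
Qed.

Lemma ract_linear t : linear (ract t).
Proof.
move=> z xi zeta; apply: rspace_ext => y; rewrite -(actVK T t y) evP.
apply: (germ_trans (ractE _ _ _)); rewrite evP linearP.
by apply: germ_sym; apply: germP; exact: ractE.
Qed.

HB.instance Definition _ t := GRing.isLinear.Build R[i] rspace rspace _ (ract t) (ract_linear t).

Lemma ract1 xi : ract 1%g xi = xi.
Proof.
apply: rspace_ext => y; have := ractE 1%g xi y.
by rewrite act1 cb1 urep1.
Qed.

Lemma ractM t t' xi : ract (t * t')%g xi = ract t (ract t' xi).
Proof.
apply: rspace_ext => y; rewrite -(actVK T (t * t')%g y).
move: (T _ y) => {}y.
apply: (germ_trans (ractE _ _ _)); rewrite cbM urepM actM; apply: germ_sym.
apply: (germ_trans (ractE _ _ _)).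
by rewrite cqE; apply: germ_act; exact: ractE.
Qed.

Lemma ract_bij t : bijective (ract t).
Proof.
exists (ract t^-1%g) => xi; first by rewrite -ractM mulVg ract1.
by rewrite -ractM mulgV ract1.
Qed.

(** The sum over components may be refined by any locally constant [f] that determines [h], with
    [tau] reading [h] off. *)
Lemma dotp_rspace (D : eqType) (f : Y -> D) (tau : D -> H) (r : seq D) xi zeta :
  lc f -> uniq r -> (forall y, f y \in r) -> (forall y, tau (f y) = h y) ->
  dotp rspace xi zeta = \sum_(d <- r)
    dotp L (Q [set x | cZ (tau d) x /\ f (cr (tau d) x) = d] (dsum_val xi (tau d)))
           (dsum_val zeta (tau d)).
Proof.
move=> lf ur fr tf; rewrite -[LHS]/(dsum_dot (D := rfam) xi zeta) /dsum_dot.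
have lfr t : lc (fun x => f (cr t x)) by apply: lc_precomp lf; exact: cr_continuous.
pose B t d := [set x | cZ t x /\ f (cr t x) = d].
have QB t d : Q ((fun x => f (cr t x)) @^-1` [set d]) (dsum_val xi t) =
    Q (B t d) (dsum_val xi t).
  rewrite -{1}rspaceZ -cprojI; last 2 first.
  - exact: lc_clopen.
  - exact: cZ_clopen.
  by rewrite setIC.
under eq_bigr => t _ do rewrite (dotp_partition Q cX (lfr t) ur (fun x => fr _)).
rewrite exchange_big /=; apply: eq_bigr => d _.
under eq_bigr => t _ do rewrite QB.
have z t : t != tau d -> Q (B t d) (dsum_val xi t) = 0.
  move=> /eqP td; suff -> : B t d = set0 by rewrite cproj_set0.
  by apply/seteqP; split=> // x [[_ hx] fx]; apply: td; rewrite -hx -fx tf.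
have [td|td] := boolP (tau d \in undup ch_values).
  rewrite (bigD1_seq (tau d)) ?undup_uniq //= big1 ?addr0 // => t /z ->.
  by rewrite linear0l.
rewrite (dsum_out (D := rfam)) ?cproj0r ?linear0l; last by rewrite -mem_undup.
rewrite big_seq big1 // => t tr; rewrite z ?linear0l //.
by apply: contraNneq td => <-.
Qed.

(** On a piece where [h y], [h (T t y)] and [b t y] are constant, [ract t] is a single unitary
    [s k], from a part of one component onto the translated part of another. The inner products
    agree piece by piece. *)
Lemma ract_dotp t xi zeta : dotp rspace (ract t xi) (ract t zeta) = dotp rspace xi zeta.
Proof.
pose f y := (h y, h (T t y), b t y).
have cT i : continuous (T i) by exact: cts_fun.
have lf : lc f.
  have l1 := lc_precomp (@cT t) (ch_lc c).
  exact: (lc_pair (lc_pair (ch_lc c) l1) (cb_lc c t)).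
have [r [ur fr]] := lc_finite cY lf.
rewrite (dotp_rspace xi zeta lf ur fr (tau := fun d => d.1.1)) //.
have lf' : lc (fun y => f (T t^-1%g y)) by exact: (lc_precomp (@cT t^-1%g) lf).
rewrite (dotp_rspace _ _ lf' ur (fun y => fr _) (tau := fun d => d.1.2)); last first.
  by move=> y; rewrite /f /= actVK.
apply: eq_bigr => -[[t1 t2] k] _ /=.
set B := [set x | cZ t1 x /\ _]; set B' := [set x | _].
have cB : clopen B.
  apply: clopenI; first exact: cZ_clopen.
  have l1 : lc (fun x => f (cr t1 x)) by apply: lc_precomp lf; exact: cr_continuous.
  exact: (lc_clopen [set (t1, t2, k)] l1).
have cB' : clopen B'.
  apply: clopenI; first exact: cZ_clopen.
  have l1 : lc (fun x => f (T t^-1%g (cr t2 x))) by apply: lc_precomp lf'; exact: cr_continuous.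
  exact: (lc_clopen [set (t1, t2, k)] l1).
have BB' : B' = S k^-1%g @^-1` B.
  apply/seteqP; split=> x /=.
    move=> [[qx hx] fx]; set y := T t^-1%g (cr t2 x) in fx.
    have yE : T t y = cr t2 x by rewrite /y actVK.
    have [e1 e2 e3] : [/\ h y = t1, h (T t y) = t2 & b t y = k] by case: fx.
    have -> : x = S k (q y) by rewrite -qx -yE cqE e3.
    rewrite actK /B /= -e1; split; first exact: cZ_q.
    by rewrite cr_q fx e1.
  move=> [[qx hx] fx]; set y := cr t1 _ in qx fx hx.
  have [e1 e2 e3] : [/\ h y = t1, h (T t y) = t2 & b t y = k] by case: fx.
  have -> : x = q (T t y) by rewrite cqE qx e3 actVK.
  rewrite /B' /= -e2; split; first exact: cZ_q.
  by rewrite cr_q actK fx e2.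
have main w : Q B' (dsum_val (ract t w) t2) = s k (Q B (dsum_val w t1)).
  rewrite cproj_act // -BB'; apply: (germ_cproj (Q := Q) cX) => // x [[qx hx] fx].
  set y := T t^-1%g (cr t2 x) in fx; have yE : T t y = cr t2 x by rewrite /y actVK.
  have := ractE t w y; rewrite yE qx /ev hx.
  by case: fx => -> _ ->.
have QQ A u v : clopen A -> dotp L (Q A u) v = dotp L (Q A u) (Q A v).
  by move=> cA; rewrite -cproj_adj // -cprojI // setIid.
by rewrite QQ // [RHS]QQ // !main urep_dotp.
Qed.

Definition rrep : unitary_rep H rspace :=
  @UnitaryRep R H rspace (fun t => ract t : {linear rspace -> rspace})
    ract1 ractM ract_bij ract_dotp.

End Rep.
End Coupling.

(** * Transfer of cochains *)

Section Transfer.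
Variables (G H : groupType) (X Y : topologicalType).
Variables (S : dynamical_system G X) (T : dynamical_system H Y) (c : coupling S T).
Variables (R : realType) (L : hilbert R) (s : unitary_rep G L) (Q : clopen_action S s).
Implicit Types (x : X) (y : Y) (t : H) (k : G) (u v : L) (xi : rspace c Q).

Local Notation p := (cp c).
Local Notation q := (cq c).
Local Notation a := (ca c).
Local Notation b := (cb c).
Local Notation g := (cg c).
Local Notation h := (ch c).
Local Notation germ := (germ Q).
Local Notation rrep := (rrep c Q).

Let cX : compact [set: X] := cX_compact c.

Definition glue (F : X -> L) : L :=
  if pselect (lc F) is left lF then projT1 (cid (glue_exists Q cX lF)) else 0.

Lemma glueE (F : X -> L) x : lc F -> germ x (glue F) (F x).
Proof. by rewrite /glue; case: pselect => // lF _; case: cid. Qed.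

Lemma germ_pull x u v : germ (q (p x)) u v -> germ x (s (g x)^-1%g u) (s (g x)^-1%g v).
Proof. by move=> /(germ_act (g x)^-1%g); rewrite cqpE actK. Qed.

Lemma lc_ev xi : lc (ev xi).
Proof. exact: (lc_comp (dsum_val xi) (ch_lc c)). Qed.

(* Pullback of sections along [p], using [q (p x) = g(x) x] to move germs back to [x]. *)
Definition pull xi : L := glue (fun x => s (g x)^-1%g (ev xi (p x))).

Lemma pullE xi x : germ x (pull xi) (s (g x)^-1%g (ev xi (p x))).
Proof.
apply: glueE; have l := lc_pair (cg_lc c) (lc_precomp (@cp_continuous _ _ _ _ _ _ c) (lc_ev xi)).
exact: (lc_comp (fun d => s d.1^-1%g d.2) l).
Qed.

Lemma pullP (z : R[i]) xi xi' : pull (z *: xi + xi') = z *: pull xi + pull xi'.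
Proof.
apply: (germ_ext (Q := Q) cX) => x; apply: (germ_trans (pullE _ _)).
by rewrite evP linearP; apply: germ_sym; apply: germP; exact: pullE.
Qed.

(** The argument [S k^-1 x] appears because sections are indexed by the target point: over [S k x]
    the value used is that of [f] at [a k x]. *)
Definition pull_cochain (f : H -> rspace c Q) k : L :=
  glue (fun x => s (g x)^-1%g (ev (f (a k (S k^-1%g x))) (p x))).

Lemma lc_pull_data k : lc (fun x => (g x, a k (S k^-1%g x), h (p x))).
Proof.
have cS : continuous (S k^-1%g) by exact: cts_fun.
have l1 := lc_precomp cS (ca_lc c k).
have l2 := lc_precomp (@cp_continuous _ _ _ _ _ _ c) (ch_lc c).
exact: (lc_pair (lc_pair (cg_lc c) l1) l2).
Qed.

Lemma pull_cochainE0 f k x :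
  germ x (pull_cochain f k) (s (g x)^-1%g (ev (f (a k (S k^-1%g x))) (p x))).
Proof.
apply: (glueE (F := fun x => s (g x)^-1%g (ev (f (a k (S k^-1%g x))) (p x)))).
exact: (lc_comp (fun d => s d.1.1^-1%g (dsum_val (f d.1.2) d.2)) (@lc_pull_data k)).
Qed.

Lemma pull_cochainE f k x :
  germ (S k x) (pull_cochain f k) (s (g (S k x))^-1%g (ev (f (a k x)) (p (S k x)))).
Proof. by have := pull_cochainE0 f k (S k x); rewrite actK. Qed.

Lemma germ_extS k u v : (forall x, germ (S k x) u v) -> u = v.
Proof.
by move=> e; apply: (germ_ext (Q := Q) cX) => x; rewrite -(actVK S k x).
Qed.

Lemma pull_cochainB f f' k :
  pull_cochain (fun t => f t - f' t) k = pull_cochain f k - pull_cochain f' k.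
Proof.
apply: (@germ_extS k) => x; apply: (germ_trans (pull_cochainE _ _ _)).
by rewrite evB linearB; apply: germ_sym; apply: germB; exact: pull_cochainE.
Qed.

(** Only the finitely many values of [a k] enter, so pointwise approximation over [H] yields
    pointwise approximation over [G]. *)
Lemma pull_cochain_bound k : exists C (l : seq H), 0 <= C /\
  forall f, norm2 (pull_cochain f k) <= C * \sum_(t <- l) norm2 (f t).
Proof.
have [r [ur fr]] := lc_finite cX (@lc_pull_data k).
exists (2 ^+ size r), [seq d.1.2 | d <- r]; split; first by rewrite exprn_ge0.
move=> f; pose F (d : G * H * H) := s d.1.1^-1%g (dsum_val (f d.1.2) d.2).
have := norm2_glue_le cX (@lc_pull_data k) ur fr (F := F) (pull_cochainE0 f k).
move=> /le_trans; apply; rewrite ler_wpM2l ?exprn_ge0 // big_map.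
apply: ler_sum => -[[k' t] t'] _; rewrite /F /= norm2_urep.
exact: norm2_dsum_le.
Qed.

(** By [cocycle_ab], [k * (g x)^-1 = (g (S k x))^-1 * b (a k x) (p x)]: near [S k x], acting by [k]
    amounts to acting by [a k x] before pulling back. *)
Lemma pull_act k x xi :
  germ (S k x) (s k (pull xi)) (s (g (S k x))^-1%g (ev (rrep (a k x) xi) (p (S k x)))).
Proof.
apply: (germ_trans (germ_act k (pullE xi x))); apply: germ_sym.
rewrite -urepM.
have -> : (k * (g x)^-1 = (g (S k x))^-1 * b (a k x) (p x))%g.
  by apply: (mulIg (g x)); rewrite -!mulgA mulVg mulg1 cocycle_ab mulgA mulVg mul1g.
rewrite urepM; apply: germ_pull; rewrite !cpE.
exact: ractE.
Qed.

Lemma pull_coboundary xi k :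
  pull_cochain (fun t => rrep t xi - xi) k = s k (pull xi) - pull xi.
Proof.
apply: (@germ_extS k) => x; apply: (germ_trans (pull_cochainE _ _ _)).
rewrite evB linearB; apply: germ_sym; apply: germB; first exact: pull_act.
exact: pullE.
Qed.

Definition push_cochain (f : G -> L) t : rspace c Q :=
  rmk c Q (fun y => f (b t (T t^-1%g y))).

Lemma push_cochainE f t y : germ (q (T t y)) (ev (push_cochain f t) (T t y)) (f (b t y)).
Proof.
rewrite -[in X in germ _ _ X](actK T t y).
apply: (@rmkE _ _ _ _ _ _ c _ _ _ Q (fun y => f (b t (T t^-1%g y)))).
have cT : continuous (T t^-1%g) by exact: cts_fun.
exact: (lc_comp f (lc_precomp cT (cb_lc c t))).
Qed.

Section Cocycle.
Variable f : G -> L.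
Hypothesis fM : forall k l, f (k * l)%g = f k + s k (f l).

Lemma push_cocycle t t' :
  push_cochain f (t * t')%g = push_cochain f t + rrep t (push_cochain f t').
Proof.
apply: rspace_ext => y; rewrite -(actVK T (t * t')%g y); move: (T _ y) => {}y.
apply: (germ_trans (push_cochainE _ _ _)); rewrite cbM fM actM; apply: germ_sym.
apply: germD; first exact: push_cochainE.
apply: (germ_trans (ractE _ _ _)); rewrite cqE; apply: germ_act.
exact: push_cochainE.
Qed.

(** Here [z] is glued from [x |-> f (g x)^-1]. By [cocycle_ab], [f] is evaluated at
    [g (S k x) * k * (g x)^-1], and the cocycle rule splits off the two outer factors as
    [s k z - z]. *)
Lemma pull_push : exists z, forall k,
  pull_cochain (push_cochain f) k = f k + (s k z - z).
Proof.
have f1 : f 1%g = 0.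
  by have := fM 1%g 1%g; rewrite mulg1 urep1 => /eqP; rewrite -subr_eq subrr eq_sym => /eqP.
have fV k : s k^-1%g (f k) = - f k^-1%g.
  by have := fM k^-1%g k; rewrite mulVg f1 => /eqP; rewrite eq_sym addrC addr_eq0 => /eqP.
have lz : lc (fun x => f (g x)^-1%g) by exact: (lc_comp (fun k => f k^-1%g) (cg_lc c)).
exists (glue (fun x => f (g x)^-1%g)) => k; apply: (@germ_extS k) => x.
apply: (germ_trans (pull_cochainE _ _ _)).
have e : germ (q (p (S k x))) (ev (push_cochain f (a k x)) (p (S k x))) (f (b (a k x) (p x))).
  by rewrite !cpE; exact: push_cochainE.
apply: (germ_trans (germ_pull e)).
have -> : b (a k x) (p x) = (g (S k x) * (k * (g x)^-1))%g.
  by apply: (mulIg (g x)); rewrite cocycle_ab -!mulgA mulVg mulg1.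
rewrite fM linearD /= urepK fV fM addrC -addrA; apply: germD; first exact: germ_refl.
apply: germB; last exact: germ_sym (glueE _ lz).
by apply: germ_act; exact: germ_sym (glueE _ lz).
Qed.

End Cocycle.

(** [pull xi] sees [xi] only over the image of [p]. All translates are needed: [p (q y) = T (h y) y]
    shows that [h y] moves [y] into that image. *)
Lemma pull_eq0 xi : (forall t, pull (rrep t xi) = 0) -> xi = 0.
Proof.
move=> e; apply: rspace_ext => y.
have := pullE (rrep (h y) xi) (q y); rewrite e cpqE => e1.
have := germ_act (g (q y)) e1; rewrite urepVK linear0 -cqpE cpqE => e2.
have := germ_trans e2 (ractE (h y) xi y); rewrite cqE => /(germ_act (b (h y) y)^-1%g).
rewrite linear0 actK urepK => e3; apply: germ_sym.
exact: e3.
Qed.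

Lemma pull_act_on k t xi :
  let A := [set x | a k (S k^-1%g x) = t] in
  Q A (s k (pull xi)) = Q A (pull (rrep t xi)).
Proof.
move=> A; have cA : clopen A.
  have cS : continuous (S k^-1%g) by exact: cts_fun.
  exact: (lc_clopen [set t] (lc_precomp cS (ca_lc c k))).
apply: (germ_cproj (Q := Q) cX) => // x Ax; rewrite -(actVK S k x).
apply: (germ_trans (pull_act _ _ _)); apply: germ_sym.
by rewrite Ax; exact: pullE.
Qed.

End Transfer.

(** * Reduced cohomology and the transfer of subrepresentations *)

Section FirstCohomology.
Variables (R : realType) (G : groupType) (V : hilbert R) (s : unitary_rep G V).

Let cst1 (k : G) : 'I_1 -> G := fun=> k.

Let ord1_eta (t : 'I_1 -> G) : t = cst1 (t ord0).
Proof. by apply/funext => i; rewrite ord1. Qed.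

(** [fun=> 1%g] stands for the only map from the empty type ['I_0] to [G]. *)
Lemma coboundary0E (f : cochain G V 0) (t : 'I_1 -> G) :
  coboundary s f t = s (t ord0) (f (fun=> 1%g)) - f (fun=> 1%g).
Proof.
rewrite /coboundary big_ord0 addr0 expr1 scaleN1r; congr (s _ (f _) - f _);
  by apply/funext => -[].
Qed.

Lemma cocycle1P (f : cochain G V 1) : cocycles s f <->
  forall k l, f (fun=> (k * l)%g) = f (fun=> k) + s k (f (fun=> l)).
Proof.
have E (t : 'I_2 -> G) : coboundary s f t =
    s (t ord0) (f (fun=> t (lift ord0 ord0))) - f (fun=> (t ord0 * t (lift ord0 ord0))%g)
    + f (fun=> t ord0).
  rewrite /coboundary big_ord_recl big_ord0 addr0 expr1 scaleN1r sqrrN expr1n scale1r.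
  congr (s _ (f _) - f _ + f _); apply/funext => i; rewrite (ord1 i) //.
    by rewrite /merge_at /=; congr (t _ * t _)%g; apply: val_inj.
  by congr (t _); apply: val_inj.
split=> [h k l|h t].
  have := h (fun i => if i == ord0 then k else l); rewrite E /= => /eqP.
  by rewrite addrAC subr_eq0 addrC => /eqP.
by rewrite E h addrAC [f _ + _]addrC subrr.
Qed.

(** A neighbourhood for pointwise convergence constrains finitely many values up to some [e]. *)
Lemma closure_coboundaries (f : cochain G V 1) :
  closure (coboundaries s (n := 1) : set (cochain G V 1)) f <->
  forall (l : seq G) (e : R), 0 < e ->
    exists v, forall k, k \in l -> norm2 (f (fun=> k) - (s k v - v)) < e.
Proof.
split=> [cf l e e0|h].
  have ev (k : G) : nbhs f [set f' : cochain G V 1 | norm2 (f (cst1 k) - f' (cst1 k)) < e].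
    have [+ _] := @pointwise_cvgP (discrete_topology ('I_1 -> G)) V
      (nbhs (f : {ptws ('I_1 -> G) -> V})) f _.
    move=> /(_ (@cvg_refl _ _) (cst1 k)) hk.
    by apply: (hk [set v | norm2 (f (cst1 k) - v) < e]); apply/nbhs_norm2; exists e.
  have nl : nbhs f [set f' : cochain G V 1 |
      forall k, k \in l -> norm2 (f (cst1 k) - f' (cst1 k)) < e].
    elim: (l) => [|k l' ih]; first exact: filterE.
    apply: filterS2 (ev k) ih => f' h1 h2 k'.
    by rewrite in_cons => /predU1P [->|/h2].
  have [_ [[f0 _ <-] hf]] := cf _ nl.
  exists (f0 (fun=> 1%g)) => k /hf; by rewrite coboundary0E.
pose A (le : seq G * R) := [set f' : cochain G V 1 | coboundaries s (n := 1) f' /\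
  forall k, k \in le.1 -> norm2 (f (cst1 k) - f' (cst1 k)) < le.2].
pose F := filter_from [set le : seq G * R | 0 < le.2] A.
have PF : ProperFilter F.
  apply: filter_from_proper.
    apply: filter_from_filter; first by exists ([::], 1) => /=.
    move=> [l1 e1] [l2 e2] /= h1 h2.
    exists (l1 ++ l2, Num.min e1 e2) => /=; first by rewrite lt_min h1.
    move=> f' [cf hf]; split; split=> // k kl; apply: (lt_le_trans (hf k _)) => /=;
      by rewrite ?mem_cat ?kl ?orbT ?ge_min ?lexx ?orbT.
  move=> [l e] /= /(h l) [v hv].
  exists (coboundary s (fun=> v : V)); split; first by exists (fun=> v : V).
  by move=> k /hv; rewrite coboundary0E.
have Ff : F --> (f : {ptws ('I_1 -> G) -> V}).
  apply/(@pointwise_cvgP (discrete_topology ('I_1 -> G)) V F f) => t B /nbhs_norm2 [e e0 hB].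
  exists ([:: t ord0], e) => //= f' [_ hf]; apply: hB.
  by have := hf (t ord0) (mem_head _ _); rewrite -ord1_eta.
move=> B nB; have FA : F (coboundaries s (n := 1)).
  by exists ([::], 1) => //= f' [].
by have [f' [? ?]] := filter_ex (filterI FA (Ff _ nB)); exists f'.
Qed.

End FirstCohomology.

Lemma lc_discrete (X : topologicalType) (D : choiceType) (f : X -> discrete_topology D) :
  continuous f -> lc (f : X -> D).
Proof. by move=> cf x; exact: (cf x [set f x] (discrete_set1 _)). Qed.

Lemma coupling_of_couple (G H : groupType) (O : orbit_couple G H) :
  oc_topologically_free O -> compact [set: oc_X O] -> compact [set: oc_Y O] ->
  inhabited (coupling (oc_GX O) (oc_HY O)).
Proof.
move=> [fX _] cX cY; have [a [b [g [h [aE bE gE hE]]]]] := oc_cocycles O.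
have pair_cont (Z : topologicalType) (D : choiceType) (k : discrete_topology D) :
    continuous (fun z : Z => (k, z)).
  move=> z A [[B C]] /= [kB zC] BC; apply: filterS zC => y Cy.
  by apply: (BC (k, y)); split=> //; exact: nbhs_singleton kB.
have la (k : G) : lc (fun x => a (k, x) : H).
  apply: lc_discrete => x; apply: (continuous_comp (pair_cont _ _ _ x)).
  exact: cts_fun.
have lb (k : H) : lc (fun y => b (k, y) : G).
  apply: lc_discrete => x; apply: (continuous_comp (pair_cont _ _ _ x)).
  exact: cts_fun.
have lg : lc (g : _ -> G) by apply: lc_discrete; exact: cts_fun.
have lh : lc (h : _ -> H) by apply: lc_discrete; exact: cts_fun.
have cp : continuous (oc_p O) by exact: cts_fun.
have cq : continuous (oc_q O) by exact: cts_fun.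
by split; exact: (Coupling cp cq la lb lg lh aE bE gE hE fX cX cY).
Qed.

Section TransferCohomology.
Variables (G H : groupType) (X Y : topologicalType).
Variables (S : dynamical_system G X) (T : dynamical_system H Y) (c : coupling S T).
Variables (R : realType) (L : hilbert R) (s : unitary_rep G L) (Q : clopen_action S s).

(** If coboundaries of vectors [xi] approximate the pushed cocycle, then those of [pull xi - z]
    approximate [f], where [z] corrects the round trip. *)
Lemma reduced_cohomology_transfer :
  reduced_cohomology_neq0 s 1 -> reduced_cohomology_neq0 (rrep c Q) 1.
Proof.
move=> ns hc; apply: ns => f /cocycle1P fM; apply/closure_coboundaries => l e e0.
pose f' k := f (fun=> k).
pose F : cochain H (rspace c Q) 1 := fun t => push_cochain c Q f' (t ord0).
have /hc/closure_coboundaries hF : cocycles (rrep c Q) F.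
  by apply/cocycle1P => t t'; rewrite /F push_cocycle.
have [z hz] := pull_push c Q (f := f') fM.
have /choice [C] : forall k, exists Cl : R * seq H, 0 <= Cl.1 /\
    forall F, norm2 (pull_cochain (c := c) (Q := Q) F k) <= Cl.1 * \sum_(t <- Cl.2) norm2 (F t).
  by move=> k; have [C [l' hl]] := pull_cochain_bound c Q k; exists (C, l').
(* [M] dominates the constants of all [k] in [l] at once; [M + 1] is positive and makes the last
   inequality strict. *)
move=> hC; pose M := \sum_(k <- l) (C k).1 * (size (C k).2)%:R.
have M0 : 0 <= M.
  by apply: sumr_ge0 => k _; rewrite mulr_ge0 //; case: (hC k).
have M1 : 0 < M + 1 by rewrite ltr_wpDl.
have [xi hxi] := hF (flatten [seq (C k).2 | k <- l]) (e / (M + 1)) (divr_gt0 e0 M1).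
exists (pull xi - z) => k kl.
pose F' t := push_cochain c Q f' t - (rrep c Q t xi - xi).
have -> : f (fun=> k) - (s k (pull xi - z) - (pull xi - z)) = pull_cochain F' k.
  rewrite /F' pull_cochainB pull_coboundary hz -addrA.
  have -> : s k (pull xi - z) = s k (pull xi) - s k z by rewrite linearB.
  congr (_ + _); rewrite !opprB addrACA [RHS]addrACA.
  by congr (_ + _); exact: addrC.
case: (hC k) => C0 /(_ F') /le_lt_trans; apply.
apply: (@le_lt_trans _ _ (M * (e / (M + 1)))).
  apply: (@le_trans _ _ ((C k).1 * (size (C k).2)%:R * (e / (M + 1)))).
    rewrite -mulrA ler_wpM2l // mulr_natl.
    have -> : (e / (M + 1)) *+ size (C k).2 = \sum_(t <- (C k).2) (e / (M + 1)).
      by rewrite big_const_seq count_predT iter_addr_0.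
    rewrite big_seq [leRHS]big_seq; apply: ler_sum => t tk; apply: ltW.
    by apply: hxi; apply/flatten_mapP; exists k.
  apply: ler_wpM2r; first by rewrite divr_ge0 // ltW.
  rewrite /M (big_rem k) //= lerDl.
  by apply: sumr_ge0 => k' _; rewrite mulr_ge0 //; case: (hC k').
by rewrite mulrCA gtr_pMr // ltr_pdivrMr // mul1r ltrDl.
Qed.

End TransferCohomology.

Lemma frame_act (R : realType) (G : groupType) (V : hilbert R) (s : unitary_rep G V)
    (W : set V) (r : seq V) k :
  (forall k v, W v -> W (s k v)) -> frame W r -> frame W [seq s k x | x <- r].
Proof.
move=> sW [rW rE]; split=> [_ /mapP [x /rW xW ->]|v vW]; first exact: sW.
rewrite -{1}(urepVK s k v) (rE _ (sW k^-1%g v vW)) linear_sum big_map.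
by apply: eq_bigr => x _; rewrite linearZ -(urep_dotp s k) urepVK.
Qed.

(** * From an invariant subspace for [H] to one for [G] *)

Section TensorTransfer.
Variables (G H : groupType) (X Y : topologicalType).
Variables (S : dynamical_system G X) (U : dynamical_system H Y) (c : coupling S U).
Variables (R : realType) (V W : hilbert R) (s : unitary_rep G V) (r : unitary_rep G W).
Variables (P : clopen_action S r) (T : tensor_rep s r) (Q : clopen_action S T).
Hypothesis slQ : forall A v (u : trep_space T), clopen A -> slice v (Q A u) = P A (slice v u).
Variables (F : set (rspace c Q)) (fr : seq (rspace c Q)).
Hypotheses (F_act : forall t v, F v -> F (rrep c Q t v)) (F_frame : frame F fr).

Let tsp : hilbert_tensor V W := trep_space T.
Let pl (xi : rspace c Q) : tsp := pull xi.

Lemma slice_act k v (u : tsp) : slice v (T k u) = r k (slice (s k^-1%g v) u).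
Proof.
apply: hilbert_ext => w; rewrite sliceE -[in RHS](urepVK r k w) urep_dotp sliceE.
by rewrite trepV.
Qed.

(* The reduced state on [V] of the frame [fr], as a quadratic form. *)
Definition qform v : R := \sum_(x <- fr) norm2 (slice v (pl x)).

(** Moving [k] to the other side gives slices of [T k^-1 (pl x)]. On the piece [A t] this vector is
    the pullback of [rrep c Q t x], and [t] carries [fr] to another frame of [F], so [frame_norm2]
    applies. By [slQ] the norms of slices add up over the pieces. *)
Lemma qform_inv k v : qform (s k v) = qform v.
Proof.
have cX := cX_compact c.
have cS i : continuous (S i) by exact: cts_fun.
pose f x := ca c k^-1%g (S k^-1%g^-1%g x).
have lf : lc f by exact: (lc_precomp (@cS _) (ca_lc c k^-1%g)).
have [l [ul fl]] := lc_finite cX lf.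
pose A t := f @^-1` [set t].
have cA t : clopen (A t) by exact: lc_clopen.
have split_sum (u : rspace c Q -> tsp) :
    \sum_(x <- fr) norm2 (slice v (u x)) =
    \sum_(t <- l) \sum_(x <- fr) norm2 (slice v (Q (A t) (u x))).
  rewrite exchange_big /=; apply: eq_bigr => x _.
  rewrite (norm2_partition P cX lf ul fl); apply: eq_bigr => t _.
  by rewrite slQ.
transitivity (\sum_(x <- fr) norm2 (slice v (T k^-1%g (pl x)))).
  by apply: eq_bigr => x _; rewrite slice_act norm2_urep invgK.
rewrite (split_sum (fun x => T k^-1%g (pl x))) /qform (split_sum pl).
apply: eq_bigr => t _.
transitivity (\sum_(x <- [seq rrep c Q t x | x <- fr]) norm2 (slice v (Q (A t) (pl x)))).
  rewrite big_map; apply: eq_bigr => x _; congr (norm2 (slice v _)).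
  exact: pull_act_on.
apply: (frame_norm2 (f := fun x => slice v (Q (A t) (pl x))) (W := F)) => //.
  exact: frame_act.
by move=> z x x'; rewrite /pl pullP cprojP sliceP.
Qed.

(** [u] acts as a Hilbert-Schmidt operator [v |-> slice v u], and finite sums of elementary tensors
    approximate it by operators of finite rank. *)
Lemma slice_compact (u : tsp) (e : R) : 0 < e -> exists (z : seq V) (d : R), 0 < d /\
  forall v, norm2 v <= 4 -> (forall y, y \in z -> csq (dotp V v y) <= d) ->
    norm2 (slice v u) <= e.
Proof.
move=> e0; have e1 : 0 < e / 16 by rewrite divr_gt0.
have [n [v [w huw]]] := tensor_approx u e1; set u' := \sum_i _ in huw.
pose N := \sum_(i < n) norm2 (w i).
have N0 : 0 <= N by apply: sumr_ge0 => i _; exact: nsq_ge0.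
have K0 : 0 < 4 * 2 ^+ n * (N + 1) :> R.
  by rewrite mulr_gt0 ?ltr_wpDl // mulr_gt0 // exprn_gt0.
(* After doubling, the remainder [u - u'] and the finite-rank part each account for at most
   [e / 2]. *)
exists [seq v i | i <- enum 'I_n], (e / (4 * 2 ^+ n * (N + 1))).
split; first by rewrite divr_gt0.
move=> x x4 hx; set d := e / _ in hx.
have dE : 4 * 2 ^+ n * (N + 1) * d = e by rewrite mulrC divfK // gt_eqF.
have d0 : 0 < d by rewrite divr_gt0.
have h1 : norm2 (slice x (u - u')) <= 4 * (e / 16).
  apply: (le_trans (norm2_slice _ _)); apply: ler_pM => //; rewrite ?nsq_ge0 //.
  exact: ltW.
have h2 : norm2 (slice x u') <= 2 ^+ n * (N * d).
  have -> : slice x u' = \sum_i dotp V (v i) x *: w i.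
    rewrite /u'; elim/big_rec2: _ => [|i y1 y2 _ <-].
      by apply: hilbert_ext => w'; rewrite sliceE !linear0l.
    by rewrite -[tens _ _ _]scale1r sliceP scale1r slice_tens.
  apply: (le_trans (nsq_sum_le _ _ _)); rewrite -[index_enum _]enumT size_enum_ord.
  rewrite ler_wpM2l ?exprn_ge0 // /N mulr_suml enumT; apply: ler_sum => i _.
  rewrite nsqZ mulrC ler_wpM2l ?nsq_ge0 //.
  have -> : csq (dotp V (v i) x) = csq (dotp V x (v i)).
    by apply: complexI; rewrite -!csqE dotpC norm_conjC.
  by apply: hx; apply/map_f/mem_enum.
have h3 := nsqD_le (dotp W) (slice x (u - u')) (slice x u').
have -> : slice x u = slice x (u - u') + slice x u'.
  by rewrite -[slice x (u - u')]scale1r -sliceP scale1r subrK.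
have h4 : 0 <= 2 ^+ n * d by rewrite mulr_ge0 ?exprn_ge0 // ltW.
apply: (le_trans h3); lra.
Qed.

Lemma qform_compact (e : R) : 0 < e -> exists (z : seq V) (d : R), 0 < d /\
  forall v, norm2 v <= 4 -> (forall y, y \in z -> csq (dotp V v y) <= d) -> qform v <= e.
Proof.
rewrite /qform; elim: (fr) e => [|x l ih] e e0.
  by exists [::], 1; split=> // v _ _; rewrite big_nil ltW.
have e2 : 0 < e / 2 by rewrite divr_gt0.
have [z1 [d1 [d10 h1]]] := slice_compact (pl x) e2.
have [z2 [d2 [d20 h2]]] := ih _ e2.
exists (z1 ++ z2), (Num.min d1 d2); split; first by rewrite lt_min d10.
move=> v v4 hv; rewrite big_cons [leRHS](splitr e); apply: lerD.
  apply: h1 => // y yz; have := hv y; rewrite mem_cat yz => /(_ isT).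
  by rewrite le_min => /andP [].
apply: h2 => // y yz; have := hv y; rewrite mem_cat yz orbT => /(_ isT).
by rewrite le_min => /andP [].
Qed.

(** If all slices of the pulled back frame vanish, [pull] kills [F]; since [F] is invariant, it
    kills all translates too, and [pull_eq0] applies. *)
Lemma qform_neq0 : (exists2 w, F w & w <> 0) -> exists v, qform v <> 0.
Proof.
move=> [w Fw w0]; apply: contrapT => h; apply: w0.
have q0 v : qform v = 0 by apply: contrapT => qv; apply: h; exists v.
have pl0 x : x \in fr -> pl x = 0.
  move=> xf; apply: tensor_eq0 => v w'; rewrite -sliceE.
  suff -> : slice v (pl x) = 0 by rewrite linear0l.
  apply: (@nsq_eq0 _ _ (dotp W)); apply/eqP; rewrite eq_le nsq_ge0 andbT -(q0 v).
  rewrite /qform (big_rem x) //= lerDl; apply: sumr_ge0 => *; exact: nsq_ge0.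
have plF xi : F xi -> pl xi = 0.
  move=> Fxi; have [_ e] := F_frame; rewrite (e _ Fxi) big_seq.
  elim/big_rec: _ => [|x y xf ih].
    by have := pullP 1 (0 : rspace c Q) 0; rewrite scaler0 addr0 scale1r => /eqP;
      rewrite -subr_eq subrr eq_sym => /eqP.
  by rewrite /pl pullP -/(pl x) -/(pl y) pl0 // ih scaler0 addr0.
by apply: pull_eq0 => t; apply: plF; exact: F_act.
Qed.

Lemma tensor_subrep : (exists2 w, F w & w <> 0) -> exists K : set V,
  [/\ subrepresentation s K, finite_dimensional K & exists2 w, K w & w <> 0].
Proof.
move=> Fne.
have sliceDl v w (u : tsp) : slice (v + w) u = slice v u + slice w u.
  by rewrite -[v]scale1r slicePl conjC1 !scale1r.
have sliceBl v w (u : tsp) : slice (v - w) u = slice v u - slice w u.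
  have -> : v - w = (- 1) *: w + v by rewrite scaleN1r addrC.
  by rewrite slicePl rmorphN1 scaleN1r addrC.
have slice0l (u : tsp) : slice 0 u = 0 by rewrite -(subrr (0 : V)) sliceBl subrr.
apply: (@compact_form_subrep R G V s qform (\sum_(x <- fr) norm2 (pl x))).
- move=> v w; rewrite /qform !mulr_sumr -!big_split; apply: eq_bigr => x _ /=.
  by rewrite sliceDl sliceBl nsq_para.
- by move=> v; apply: sumr_ge0 => *; exact: nsq_ge0.
- move=> z v; rewrite /qform mulr_sumr; apply: eq_bigr => x _.
  rewrite -[z *: v]addr0 slicePl slice0l addr0 nsqZ; congr (_ * _).
  by case: z => z1 z2; rewrite /csq /= sqrrN.
- move=> v; rewrite mulr_suml; apply: ler_sum => x _; rewrite mulrC.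
  exact: norm2_slice.
- exact: qform_inv.
- exact: qform_compact.
- exact: qform_neq0.
Qed.

End TensorTransfer.

Theorem theorem3p18 (R : realType) (G H : groupType)
    (hG : countable [set: G]) (hH : countable [set: H])
    (hO : exists O : orbit_couple G H,
        oc_topologically_free O /\ H1_faithful R O)
    (hHFD : property_HFD R H) :
  property_HFD R G.
Proof.
move=> V s hs; have [couple [fO [_ _ cX cY /(_ V s hs) [W [P [T hT]]]]]] := hO.
have [c] := coupling_of_couple fO cX cY.
have [Q slQ] := tensor_clopen (covariant_clopen P) T.
have [F [Fsub Ffd Fne]] := hHFD _ (rrep c Q) (reduced_cohomology_transfer (c := c) (Q := Q) hT).
have [fr Ffr] := frame_exists Ffd.
exact: (tensor_subrep slQ (subrep_stable Fsub) Ffr Fne).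
Qed.
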